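(* Let $H$ be a separable real Hilbert space and let $A$ be a self-adjoint nonnegative (possibly unbounded) linear operator on $H$ with dense domain $D(A)$. Assume that there exist a countable (not necessarily complete) orthonormal system $\{e_k\}_{k\ge 1}$ in $H$ and an increasing unbounded sequence $\{\lambda_k\}_{k\ge 1}$ of positive real numbers such that $Ae_k=\lambda_k^2e_k$ for every $k\ge 1$. Let $\omega:[0,+\infty)\to[0,+\infty)$ be a continuous increasing function such that $\omega(0)=0$, $\omega(a+b)\le\omega(a)+\omega(b)$ for every $a\ge 0$, $b\ge 0$, and such that the function $\sigma\mapsto\sigma/\omega(\sigma)$ is nondecreasing. Let $\varphi:[0,+\infty)\to[1,+\infty)$ be a function such that $$\lim_{\sigma\to+\infty}\frac{\sigma}{\varphi(\sigma)}\,\omega\left(\frac1\sigma\right)=+\infty .$$ Then there exist $c:[0,1]\to[1/2,3/2]$ and $v:[0,1]\to H$ such that (1) $c$ is $\omega$-continuous; (2) $(v(0),v'(0))\in\mathcal{G}_{\varphi,r,3/4}(A)\times\mathcal{G}_{\varphi,r,1/4}(A)$ for every $r>0$; (3) $v\in C^1([0,1];D(A^{1/4}))\cap C^0([0,1];D(A^{3/4}))$ is a solution of the linear equation $v''(t)+c(t)Av(t)=0$; (4) for every $t\in(0,1]$ we have that $(v(t),v'(t))\notin V_\beta$ for every $\beta>1/2$.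
   Context: A function $f:X\to\mathbb{R}$ with $X\subseteq\mathbb{R}$ is $\omega$-continuous if there is a constant $L\in\mathbb{R}$ with $|f(a)-f(b)|\le L\,\omega(|a-b|)$ for all $a,b\in X$. The powers $A^\beta$ ($\beta\ge0$), with domains $D(A^\beta)$, are those given by the spectral theorem. The phase spaces are $V_\beta:=D(A^{(\beta+1)/2})\times D(A^{\beta/2})$. Spaces $\mathcal{G}_{\varphi,r,\beta}(A)$ (for $r>0$, $\beta>0$): if $u=\sum_k u_k e_k$ lies in the closed span of orthonormal eigenvectors $e_k$ with $Ae_k=\lambda_k^2e_k$, set $$\|u\|^2_{\varphi,r,\beta}:=\sum_{k}\lambda_k^{4\beta}u_k^2\exp\left(r\varphi(\lambda_k)\right),$$ and $\mathcal{G}_{\varphi,r,\beta}(A):=\{u\in H:\|u\|^2_{\varphi,r,\beta}<+\infty\}$. (For a general $A$ and general $u\in H$ the sum is replaced by the corresponding spectral integral given by the spectral theorem.) The differential equation is understood in the usual weak sense (as an equality in the dual space $D(A^{-1/4})$ of $D(A^{1/4})$). *)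

(* Defs.v *)
From HB Require Import structures.
From mathcomp Require Export all_boot all_order all_algebra sesquilinear.
From mathcomp Require Import ring.
From mathcomp Require Export all_classical all_reals all_analysis measurable_realfun.
Export Order.TTheory GRing.Theory Num.Theory.
Export numFieldNormedType.Exports.

Set Implicit Arguments.
Unset Strict Implicit.
Unset Printing Implicit Defensive.

#[export] Set Implicit Arguments.
#[export] Unset Strict Implicit.
#[export] Unset Printing Implicit Defensive.

Local Open Scope classical_set_scope.
Local Open Scope ring_scope.

Section HilbertSpace.
Context {R : realType} {H : completeNormedModType R}.

(* A real Hilbert space is a complete normed space whose norm comes from an
   inner product. *)
Record inner_product := InnerProduct {
  ip :> {dot H for idfun};
  ip_norm : forall u : H, `|u| ^+ 2 = ip u u }.

Variable ip : inner_product.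
Implicit Types u v w : H.

Lemma ip_sym u v : ip u v = ip v u.
Proof. by rewrite [LHS](hermitian_subproof (s := ip)) expr0 mul1r. Qed.

Lemma ipDr u v w : ip u (v + w) = ip u v + ip u w.
Proof. by rewrite raddfD. Qed.

Lemma ipNr u v : ip u (- v) = - ip u v.
Proof. by rewrite raddfN. Qed.

Lemma ipDl u v w : ip (u + v) w = ip u w + ip v w.
Proof. by rewrite ip_sym ipDr ip_sym (ip_sym w v). Qed.

Lemma ipNl u v : ip (- u) v = - ip u v.
Proof. by rewrite ip_sym ipNr ip_sym. Qed.

Lemma ip_polar u w : ip u w = 4^-1 * (`|u + w| ^+ 2 - `|u - w| ^+ 2).
Proof. by rewrite !(ip_norm ip) !ipDr !ipDl !ipNr !ipNl (ip_sym w u); field. Qed.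

End HilbertSpace.
Arguments inner_product {R} H.

Section Operators.
Context {R : realType} {H : completeNormedModType R} (ip : inner_product H).

(* A possibly unbounded operator is given by its domain [D] and by a function
   [A] whose values outside [D] are irrelevant. In [sa_adjoint] the left-hand
   side says that (u, z) belongs to the graph of the adjoint of A, so that
   A = A^*, domains included. *)
Record self_adjoint (D : set H) (A : H -> H) : Prop := SelfAdjoint {
  sa_dom0 : D 0;
  sa_domP : forall a u w, D u -> D w -> D (a *: u + w);
  sa_linear : forall a u w, D u -> D w -> A (a *: u + w) = a *: A u + A w;
  sa_dense : dense D;
  sa_adjoint : forall u z,
    (forall w, D w -> ip (A w) u = ip w z) <-> (D u /\ z = A u) }.

(* projection-valued measures on the Borel sets of the real line *)
Record pvm := Pvm {
  pvm_proj :> set (measurableTypeR R) -> H -> H;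
  pvm_linear : forall B, measurable B ->
    forall a u w, pvm_proj B (a *: u + w) = a *: pvm_proj B u + pvm_proj B w;
  pvm_sym : forall B, measurable B ->
    forall u w, ip (pvm_proj B u) w = ip u (pvm_proj B w);
  pvm_setI : forall B C, measurable B -> measurable C ->
    forall u, pvm_proj (B `&` C) u = pvm_proj B (pvm_proj C u);
  pvm_set0 : forall u, pvm_proj set0 u = 0;
  pvm_setT : forall u, pvm_proj setT u = u;
  pvm_sigma_additive : forall F : (set (measurableTypeR R))^nat,
    (forall n, measurable (F n)) -> trivIset setT F ->
    forall u, (\sum_(0 <= k < n) pvm_proj (F k) u) @[n --> \oo]
                --> pvm_proj (\bigcup_n F n) u }.

Section SpectralMeasure.
Variables (E : pvm) (u : H).

(* B |-> <E(B) u, u> *)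
Definition spectral_measure (B : set (measurableTypeR R)) : \bar R :=
  (`|E B u| ^+ 2)%:E.

Let spectral_measureE B : measurable B -> `|E B u| ^+ 2 = ip (E B u) u.
Proof. by move=> mB; rewrite (ip_norm ip) pvm_sym// -pvm_setI// setIid -pvm_sym. Qed.

Let spectral_measure0 : spectral_measure set0 = 0%E.
Proof. by rewrite /spectral_measure pvm_set0 normr0 expr0n. Qed.

Let spectral_measure_ge0 B : (0 <= spectral_measure B)%E.
Proof. by rewrite lee_fin sqr_ge0. Qed.

Let spectral_measure_sigma_additive : semi_sigma_additive spectral_measure.
Proof.
move=> F mF tF mUF; rewrite /spectral_measure spectral_measureE//.
have -> : (fun n => \sum_(0 <= i < n) (`|E (F i) u| ^+ 2)%:E)%E =
    EFin \o (fun n => ip (\sum_(0 <= k < n) E (F k) u) u).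
  apply/funext => n /=; rewrite sumEFin; congr EFin.
  elim: n => [|n IHn].
    by rewrite !big_geq// ip_polar add0r sub0r normrN subrr mulr0.
  rewrite !big_nat_recr//= IHn spectral_measureE//.
  by rewrite ipDl.
apply: cvg_EFin; first exact: nearW.
rewrite (_ : fine \o _ = fun n => ip (\sum_(0 <= k < n) E (F k) u) u)//.
under eq_fun do rewrite ip_polar.
rewrite ip_polar; have cv := @pvm_sigma_additive E F mF tF u.
have cvg_sqr (f : nat -> H) (l : H) :
    f n @[n --> \oo] --> l -> `|f n| ^+ 2 @[n --> \oo] --> `|l| ^+ 2.
  move=> fl; rewrite expr2; under eq_fun do rewrite expr2.
  by apply: cvgM; exact: cvg_norm.
apply: cvgMr; apply: cvgB; apply: cvg_sqr.
- by apply: cvgD => //; exact: cvg_cst.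
- by apply: cvgB => //; exact: cvg_cst.
Qed.

HB.instance Definition _ := isMeasure.Build _ (measurableTypeR R) R
  spectral_measure spectral_measure0 spectral_measure_ge0
  spectral_measure_sigma_additive.

End SpectralMeasure.

Section FunctionalCalculus.
Variable E : pvm.

Definition fcalc_dom (f : R -> R) : set H :=
  [set u | (\int[spectral_measure E u]_x ((f x) ^+ 2)%:E < +oo)%E].

(* the integral of f against the signed measure <E(.) u, w>, by polarization *)
Definition fcalc_form (f : R -> R) (u w : H) : R :=
  4^-1 * (Rintegral (spectral_measure E (u + w)) setT f
        - Rintegral (spectral_measure E (u - w)) setT f).

(* y is the value at u of the operator "integral of f dE" *)
Definition fcalc (f : R -> R) (u y : H) : Prop :=
  fcalc_dom f u /\ forall w, fcalc_dom f w -> ip y w = fcalc_form f u w.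

(* A is the integral of x dE. By the spectral theorem every self-adjoint A has
   exactly one such E; powers and spectral integrals of A are taken in terms
   of it. *)
Definition spectral_resolution (D : set H) (A : H -> H) : Prop :=
  forall u y, (D u /\ A u = y) <-> fcalc idfun u y.

(* When E resolves a nonnegative operator it is null on the negative half-line,
   so the values of [powR] there play no role in what follows. *)
Definition pow_dom (b : R) : set H := fcalc_dom (fun x => x `^ b).

Definition op_pow (b : R) (u : H) : H :=
  xget 0 [set y | fcalc (fun x => x `^ b) u y].

(* the norm of D(A^b) *)
Definition graph_norm (b : R) (u : H) : R :=
  Num.sqrt (`|u| ^+ 2 + `|op_pow b u| ^+ 2).

(* the norm of the dual space D(A^(-b)) of D(A^b) *)
Definition dual_norm (b : R) (l : H -> R) : \bar R :=
  ereal_sup [set `|l w|%:E | w in [set w | pow_dom b w /\ graph_norm b w <= 1]].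

(* A v as an element of D(A^(-1/4)), for v in D(A^(3/4)) *)
Definition op_dual (v w : H) : R := ip (op_pow (3 / 4) v) (op_pow (1 / 4) w).

Definition phase_space (b : R) : set (H * H) :=
  pow_dom ((b + 1) / 2) `*` pow_dom (b / 2).

(* In the variable x = lambda ^ 2 of A. As phi is an arbitrary function, the
   integrand is only required to be measurable for the completion of the
   spectral measure of u. This is no restriction when u is in the closed span
   of eigenvectors: that measure is then a countable sum of point masses and
   the integral is the sum of the series. *)
Definition gevrey (phi : R -> R) (r b : R) : set H := [set u |
  exists g : measurableTypeR R -> \bar R,
    [/\ measurable_fun [set: measurableTypeR R] g,
        {ae spectral_measure E u, forall x : R,
          g x = (Num.sqrt x `^ (4 * b) * expR (r * phi (Num.sqrt x)))%:E} &
        (\int[spectral_measure E u]_x g x < +oo)%E]].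

(* Functions on [0, 1] are functions on R whose values elsewhere are
   irrelevant: limits are taken within [0, 1]. *)
Definition cont01 (b : R) (v : R -> H) : Prop :=
  forall t, t \in `[0, 1] -> pow_dom b (v t) /\
    graph_norm b (v s - v t) @[s --> within `[0, 1] (nbhs t)] --> 0.

(* v' is the derivative of v : [0, 1] -> D(A^b), one-sided at the endpoints *)
Definition deriv01 (b : R) (v v' : R -> H) : Prop :=
  forall t, t \in `[0, 1] -> [/\ pow_dom b (v t), pow_dom b (v' t) &
    graph_norm b ((s - t)^-1 *: (v s - v t) - v' t)
      @[s --> within `[0, 1] t^'] --> 0].

(* v'' is the derivative of v' as a function from [0, 1] to D(A^(-b)), where
   u in H is identified with the functional <u, .> *)
Definition dual_deriv01 (b : R) (v' : R -> H) (v'' : R -> H -> R) : Prop :=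
  forall t, t \in `[0, 1] ->
    dual_norm b (fun w => ip ((s - t)^-1 *: (v' s - v' t)) w - v'' t w)
      @[s --> within `[0, 1] t^'] --> 0%E.

Definition wave_solution (c : R -> R) (v v' : R -> H) : Prop :=
  exists v'' : R -> H -> R, dual_deriv01 (1 / 4) v' v'' /\
    forall t, t \in `[0, 1] -> forall w, pow_dom (1 / 4) w ->
      v'' t w + c t * op_dual (v t) w = 0.

End FunctionalCalculus.
End Operators.

Definition omega_continuous {R : realType} (omega : R -> R) (X : set R)
    (f : R -> R) : Prop :=
  exists L : R, forall a b, X a -> X b -> `|f a - f b| <= L * omega `|a - b|.

(* Main.v *)
(** Along a sparse subsequence of eigenvectors one looks for a solution
    [v t = sum_k u_k t *: e_(n k)], so that each [u_k] solves the scalar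
    equation [u'' + L_k^2 c u = 0] with [L_k = lam (n k)]. The coefficient [c]
    is 1 outside disjoint intervals [[t_k, s_k]] accumulating at 0; on the k-th
    one it oscillates at frequency [L_k] with amplitude of order
    [eps_k = omega (1 / L_k)], in exact parametric resonance with [u_k]: there
    [u_k = (al_k / L_k) sin x exp (eps_k (x - sin x cos x) / 2)] with
    [x = L_k (t - t_k)], and the energy [u_k'^2 + L_k^2 u_k^2] is multiplied by
    [exp (eps_k L_k (s_k - t_k))]. As [L omega (1 / L) / phi L] is unbounded,
    choosing [L_k] large makes this factor beat [exp (k phi L_k)], so the modes
    are tiny at time 0. Before [t_k] the mode is not amplified, because
    [s_(k+1) <= 1 / L_k]; after [s_k] its energy varies at most by a factor
    [M_k] which depends only on the earlier choices, and [L_k] is taken larger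
    than [(2^k M_k^2)^k]. Normalizing the energy at [s_k] by
    [2^-k / (M_k L_k)] gives a sum that converges in the [V_(1/2)] norm
    uniformly in time, and in no better space at any positive time. *)

Require Import Defs.
From mathcomp Require Import ring lra.

Local Open Scope classical_set_scope.
Local Open Scope ring_scope.

(** * Hilbert space expansions *)

(** The coefficient is shared by all modes, so the mode of frequency L_k also crosses the intervals
    tuned to the other ones, and two different energies are needed. Intervals at later times are
    fixed before L_k is chosen: there [u'^2 + l^2 c u^2] varies at a rate controlled by c' and
    independent of l, so M_k is known before L_k. Intervals at earlier times are still unknown when
    L_k is chosen, and only |c - 1| <= 1/2 is available: [u'^2 + l^2 u^2] then grows at rate at most
    l / 2, which is harmless during a time 1 / L_k. The amplitude is dictated by regularity: at
    frequency L an oscillation of size eps varies by about eps over a distance 1 / L, so eps may be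
    of order omega (1 / L) and no more. After s_k the energy times L_k is at least 2^-k / M_k^2: one
    M_k comes from the normalization, the other from the variation after s_k. The outer power k
    makes this at least L_k^(-1/k), which any positive power of L_k defeats for large k. On the
    operator side the resolution of A is given in weak form and the eigenvectors need not be
    complete, so powers of A on infinite sums are identified through norms as well as
    coefficients. *)

Section InnerProduct.
Context {R : realType} {H : completeNormedModType R} (ip : inner_product H).
Implicit Types u v w : H.

Lemma ipZr (a : R) u w : ip u (a *: w) = a * ip u w.
Proof. by rewrite linearZ. Qed.

Lemma ipZl (a : R) u w : ip (a *: u) w = a * ip u w.
Proof. by rewrite ip_sym ipZr ip_sym. Qed.

Lemma ip0r u : ip u 0 = 0.
Proof. by rewrite raddf0. Qed.

Lemma ip_sumr I (r : seq I) (P : pred I) u (F : I -> H) :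
  ip u (\sum_(i <- r | P i) F i) = \sum_(i <- r | P i) ip u (F i).
Proof. exact: raddf_sum. Qed.

Lemma ip_suml I (r : seq I) (P : pred I) u (F : I -> H) :
  ip (\sum_(i <- r | P i) F i) u = \sum_(i <- r | P i) ip (F i) u.
Proof. by rewrite ip_sym ip_sumr; apply: eq_bigr => i _; rewrite ip_sym. Qed.

Lemma normD_sqr u w : `|u + w| ^+ 2 = `|u| ^+ 2 + 2 * ip u w + `|w| ^+ 2.
Proof.
by rewrite !(ip_norm ip) ipDr !ipDl (ip_sym ip w u); ring.
Qed.

Lemma normB_sqr u w : `|u - w| ^+ 2 = `|u| ^+ 2 - 2 * ip u w + `|w| ^+ 2.
Proof. by rewrite normD_sqr ipNr normrN; ring. Qed.

(** Cauchy-Schwarz, read off from the squared distance of [u] to its projection on the line of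
    [w]. *)
Lemma ip_le u w : `|ip u w| <= `|u| * `|w|.
Proof.
have [->|w0] := eqVneq w 0; first by rewrite ip0r !normr0 mulr0.
have nw : 0 < `|w| by rewrite normr_gt0.
rewrite -(@ler_pXn2r _ 2)// ?nnegrE ?mulr_ge0// real_normK ?num_real// exprMn.
pose a := ip u w / `|w| ^+ 2.
have : 0 <= `|u - a *: w| ^+ 2 by rewrite sqr_ge0.
rewrite normB_sqr ipZr normrZ exprMn real_normK ?num_real//.
have -> : `|u| ^+ 2 - 2 * (a * ip u w) + a ^+ 2 * `|w| ^+ 2 =
   (`|u| ^+ 2 * `|w| ^+ 2 - ip u w ^+ 2) / `|w| ^+ 2.
  by rewrite /a; field; rewrite gt_eqF.
by rewrite pmulr_lge0 ?invr_gt0 ?exprn_gt0// subr_ge0.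
Qed.

Lemma cvg_ipl (T : Type) (F : set_system T) {FF : Filter F} (f : T -> H) l w :
  f @ F --> l -> ip (f x) w @[x --> F] --> ip l w.
Proof.
move=> fl; rewrite ip_polar; under eq_fun do rewrite ip_polar.
have sq (g : T -> H) m : g @ F --> m -> `|g x| ^+ 2 @[x --> F] --> `|m| ^+ 2.
  by move=> gm; rewrite expr2; under eq_fun do rewrite expr2; apply: cvgM; exact: cvg_norm.
apply: cvgMr; apply: cvgB; apply: sq.
- by apply: cvgD => //; exact: cvg_cst.
- by apply: cvgB => //; exact: cvg_cst.
Qed.

End InnerProduct.

Section Synthesis.
Context {R : realType} {H : completeNormedModType R} (ip : inner_product H).
Variable (f : nat -> H).
Hypothesis f_orthonormal : forall i j, ip (f i) (f j) = (i == j)%:R.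
Implicit Types a b : nat -> R.

Definition ell2 a := cvgn (series (fun k => a k ^+ 2)).

(** [limn] has an arbitrary value on a divergent series; [ell2 a] is the condition under which this
    is a genuine sum. *)
Definition synth a : H := limn (series (fun k => a k *: f k)).

Lemma normr_sum_sqr (r : seq nat) a : uniq r ->
  `|\sum_(k <- r) a k *: f k| ^+ 2 = \sum_(k <- r) a k ^+ 2.
Proof.
move=> ur; rewrite (ip_norm ip) ip_suml big_seq [RHS]big_seq.
apply: eq_bigr => k kr; rewrite ip_sumr (bigD1_seq k)//= ipZl ipZr f_orthonormal eqxx.
rewrite big1 ?addr0 ?mulr1 ?expr2// => i ik.
by rewrite ipZl ipZr f_orthonormal eq_sym (negbTE ik) !mulr0.
Qed.

(** By Pythagoras the Cauchy criterion for the squares is the Cauchy criterion in H, which is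
    complete. *)
Lemma synth_cvg a : ell2 a -> series (fun k => a k *: f k) @ \oo --> synth a.
Proof.
move=> /cauchy_cvgP/cauchy_seriesP ca.
apply/cauchy_cvgP/cauchy_seriesP => e e0.
move: (ca (e ^+ 2)); rewrite exprn_gt0// => /(_ isT); apply: filterS => -[m n] /=.
move=> h; rewrite -(@ltr_pXn2r _ 2)// ?nnegrE// ?(ltW e0)// normr_sum_sqr ?iota_uniq//.
by apply: le_lt_trans h; rewrite ler_norm.
Qed.

Lemma ip_synthl a w : ell2 a ->
  series (fun k => a k * ip (f k) w) @ \oo --> ip (synth a) w.
Proof.
move=> /synth_cvg/(cvg_ipl (ip := ip) (w := w)); apply: cvg_trans.
have -> // : (fun n => ip (series (fun k => a k *: f k) n) w) = series (fun k => a k * ip (f k) w).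
apply/funext => n; rewrite /series/= ip_suml.
by apply: eq_bigr => i _; rewrite ipZl.
Qed.

Lemma norm_synth a : ell2 a ->
  series (fun k => a k ^+ 2) @ \oo --> `|synth a| ^+ 2.
Proof.
move=> /synth_cvg fa.
have -> : series (fun k => a k ^+ 2) =
    (fun n => `|series (fun k => a k *: f k) n| * `|series (fun k => a k *: f k) n|).
  by apply/funext => n; rewrite -expr2 /series/= normr_sum_sqr ?iota_uniq.
by rewrite expr2; apply: cvgM; exact: cvg_norm.
Qed.

Lemma synth_coef a k : ell2 a -> ip (synth a) (f k) = a k.
Proof.
move=> la; apply: (cvg_unique _ (ip_synthl (w := f k) la)) => //.
apply: cvg_near_cst; exists k.+1 => // n /= kn; rewrite /series/=.
rewrite big_mkord (bigD1 (Ordinal kn))//= f_orthonormal eqxx mulr1 big1 ?addr0//.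
move=> i ik; rewrite f_orthonormal; case: eqP => [ik'|]; last by rewrite mulr0.
by move: ik; rewrite -(inj_eq val_inj)/= ik' eqxx.
Qed.

Lemma cvg_synth_lin (x : R) a b : ell2 a -> ell2 b ->
  series (fun k => (x * a k + b k) *: f k) @ \oo --> x *: synth a + synth b.
Proof.
move=> /synth_cvg fa /synth_cvg fb.
rewrite (_ : series _ = (fun n => x *: series (fun k => a k *: f k) n +
   series (fun k => b k *: f k) n)); last first.
  apply/funext => n; rewrite /series/= scaler_sumr -big_split/=.
  by apply: eq_bigr => i _; rewrite scalerDl scalerA.
by apply: cvgD => //; apply: cvgZr.
Qed.

Lemma synth_lin (x : R) a b : ell2 a -> ell2 b ->
  synth (fun k => x * a k + b k) = x *: synth a + synth b.
Proof. by move=> la lb; apply: cvg_lim => //; exact: cvg_synth_lin. Qed.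

Lemma ell2_le a b : (forall k, `|a k| <= `|b k|) -> ell2 b -> ell2 a.
Proof.
move=> ab; apply: series_le_cvg => [k|k|k]; rewrite ?sqr_ge0//.
by rewrite -[leLHS]real_normK ?num_real// -[leRHS]real_normK ?num_real// lerXn2r// ?nnegrE.
Qed.

Lemma ell2Z (x : R) a : ell2 a -> ell2 (fun k => x * a k).
Proof.
move=> la; rewrite /ell2 (_ : series _ = (fun n => x ^+ 2 * series (fun k => a k ^+ 2) n)).
  by apply: is_cvgMr.
by apply/funext => n; rewrite /series/= mulr_sumr; apply: eq_bigr => i _; rewrite exprMn.
Qed.

Lemma ell2D a b : ell2 a -> ell2 b -> ell2 (fun k => a k + b k).
Proof.
move=> la lb.
apply: (@series_le_cvg _ _ (fun k => 2 * (a k ^+ 2) + 2 * (b k ^+ 2))) => [k|k|k|].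
- exact: sqr_ge0.
- by rewrite addr_ge0// mulr_ge0// sqr_ge0.
- have := sqr_ge0 (a k - b k); nra.
- rewrite (_ : series _ = (fun n => 2 * series (fun k => a k ^+ 2) n +
     2 * series (fun k => b k ^+ 2) n)).
    by apply: is_cvgD; apply: is_cvgMr.
  by apply/funext => n; rewrite /series/= !mulr_sumr -big_split.
Qed.

End Synthesis.

(** * Spectral measures and functional calculus *)

Section MeasureSum.
Context {d} {T : measurableType d} {R : realType}.
Variables m m1 m2 : {measure set T -> \bar R}.
Hypothesis m12 : forall C, measurable C -> m C = (m1 C + m2 C)%E.

(** The measures are compared on measurable sets only, because identities between spectral measures
    are available only there. *)
Lemma ge0_integral_msum2 (f : T -> \bar R) :
  (forall x, (0 <= f x)%E) -> measurable_fun setT f ->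
  (\int[m]_x f x = \int[m1]_x f x + \int[m2]_x f x)%E.
Proof.
move=> f0 mf; rewrite -ge0_integral_measure_add//.
by apply: eq_measure_integral => C mC _; rewrite m12//; exact/esym/measure_addE.
Qed.

Lemma integrable_msum2 (f : T -> \bar R) :
  m1.-integrable setT f -> m2.-integrable setT f -> m.-integrable setT f.
Proof.
move=> /integrableP[mf i1] /integrableP[_ i2]; apply/integrableP; split => //.
rewrite ge0_integral_msum2//; first exact: lte_add_pinfty.
by apply: measurableT_comp.
Qed.

Lemma Rintegral_msum2 (f : T -> R) :
  m1.-integrable setT (EFin \o f) -> m2.-integrable setT (EFin \o f) ->
  Rintegral m setT f = Rintegral m1 setT f + Rintegral m2 setT f.
Proof.
move=> i1 i2; have mf := measurable_int _ i1.
rewrite /Rintegral -fineD; try exact: integrable_fin_num.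
rewrite -integral_measure_add//; congr fine.
by apply: eq_measure_integral => C mC _; rewrite m12//; exact/esym/measure_addE.
Qed.

End MeasureSum.

Section Pvm.
Context {R : realType} {H : completeNormedModType R} {ip : inner_product H}.
Variable E : pvm ip.
Implicit Types (u v w : H) (B C : set (measurableTypeR R)) (f : R -> R).

Local Notation mu := (spectral_measure E).

Section Fixed.
Variables (B : set (measurableTypeR R)) (mB : measurable B).

Lemma pvmZ a u : E B (a *: u) = a *: E B u.
Proof.
have := pvm_linear E mB a u 0; rewrite addr0 => ->.
have -> : E B 0 = 0; last by rewrite addr0.
have := pvm_linear E mB (-1) (0 : H) 0.
by rewrite scaler0 addr0 scaleN1r addNr.
Qed.

Lemma pvm0 : E B 0 = 0.
Proof. by have := pvmZ 0 0; rewrite !scale0r. Qed.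

Lemma pvmD u w : E B (u + w) = E B u + E B w.
Proof. by have := pvm_linear E mB 1 u w; rewrite !scale1r. Qed.

Lemma pvmB u w : E B (u - w) = E B u - E B w.
Proof. by rewrite pvmD -scaleN1r pvmZ scaleN1r. Qed.

Lemma pvm_sum I (r : seq I) (F : I -> H) :
  E B (\sum_(i <- r) F i) = \sum_(i <- r) E B (F i).
Proof.
elim: r => [|i r IH]; first by rewrite !big_nil pvm0.
by rewrite !big_cons pvmD IH.
Qed.

Lemma pvm_idem u : E B (E B u) = E B u.
Proof. by rewrite -pvm_setI// setIid. Qed.

Lemma ip_pvm u w : ip (E B u) (E B w) = ip (E B u) w.
Proof. by rewrite -pvm_sym// pvm_idem. Qed.

Lemma pvm_norm_le u : `|E B u| <= `|u|.
Proof.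
have [->|h] := eqVneq (E B u) 0; first by rewrite normr0.
rewrite -(@ler_pM2l _ `|E B u|) ?normr_gt0// -expr2 (ip_norm ip) ip_pvm.
by apply: le_trans (ip_le ip _ _); rewrite ler_norm.
Qed.

Lemma pvm_cvg (F : nat -> H) l : F n @[n --> \oo] --> l ->
  E B (F n) @[n --> \oo] --> E B l.
Proof.
move=> Fl; apply/cvgrPdist_le => e e0; near=> n.
rewrite -pvmB; apply: le_trans (pvm_norm_le _) _.
by near: n; move/cvgrPdist_le : Fl; apply.
Unshelve. all: by end_near. Qed.

End Fixed.

Lemma pvm_disj B C u : measurable B -> measurable C -> B `&` C = set0 ->
  E B (E C u) = 0.
Proof. by move=> mB mC BC; rewrite -pvm_setI// BC pvm_set0. Qed.

Lemma pvm_add B u : measurable B -> E B u + E (~` B) u = u.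
Proof.
move=> mB; have mCB := measurableC mB.
pose F := bigcup2 B (~` B).
have mF n : measurable (F n) by rewrite /F /bigcup2; case: n => [//|[//|n]] /=; exact: measurable0.
have tF : trivIset setT F by rewrite -trivIset_bigcup2 setICr.
have := @pvm_sigma_additive _ _ _ E F mF tF u.
rewrite bigcup2E setUv pvm_setT => h; apply: (cvg_unique _ _ h) => //.
apply: cvg_near_cst; exists 2%N => // n /= n2.
rewrite big_mkord -(subnKC n2) !big_ord_recl/= big1 ?addr0// => i _.
by rewrite /F/= pvm_set0.
Qed.

Lemma spectralT u : mu u setT = (`|u| ^+ 2)%:E.
Proof. by rewrite /spectral_measure pvm_setT. Qed.

Lemma spectral_pvm B C u : measurable B -> measurable C ->
  mu (E B u) C = mu u (C `&` B).
Proof. by move=> mB mC; rewrite /spectral_measure pvm_setI. Qed.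

(** The parallelogram identity for [E C u] and [E C w]. It makes [fcalc_dom] stable under sums and
    differences, as the polarized form requires. *)
Lemma spectral_parallelogram u w C : measurable C ->
  (measure_add (mu (u + w)%R) (mu (u - w)%R) C =
   measure_add (mu u) (mu w) C + measure_add (mu u) (mu w) C)%E.
Proof.
move=> mC; rewrite !measure_addE /spectral_measure -!EFinD; congr EFin.
by rewrite pvmD// pvmB// (normD_sqr ip) (normB_sqr ip); ring.
Qed.

Lemma spectral_orth u w C : measurable C ->
  ip (E C u) w = 0 -> mu (u + w)%R C = (mu u C + mu w C)%E.
Proof.
move=> mC uw; rewrite /spectral_measure -EFinD; congr EFin.
by rewrite pvmD// (normD_sqr ip) ip_pvm// uw mulr0 addr0.
Qed.

Section Dom.
Variables (f : R -> R) (mf : measurable_fun setT f).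

Let mf2 : measurable_fun setT (fun x : measurableTypeR R => ((f x) ^+ 2)%:E).
Proof. by apply/measurable_EFinP; exact: measurable_funX. Qed.

(** The spectral measure is finite, so square integrability implies integrability, through
    [|f| <= 1 + f ^+ 2]. *)
Lemma fcalc_dom_integrable u : fcalc_dom E f u ->
  (mu u).-integrable setT (EFin \o f).
Proof.
move=> du; apply/integrableP; split; first exact/measurable_EFinP.
apply: (@le_lt_trans _ _ (\int[mu u]_x (1%:E + ((f x) ^+ 2)%:E))%E).
  apply: ge0_le_integral => //=.
  - by apply/measurable_EFinP; exact: measurableT_comp.
  - exact: emeasurable_funD.
  - move=> x _; rewrite -EFinD lee_fin -(real_normK (num_real (f x))).
    have := sqr_ge0 (`|f x| - 1); have := normr_ge0 (f x); nra.
rewrite ge0_integralD//=; last by move=> x _; rewrite lee_fin sqr_ge0.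
by rewrite integral_cst// mul1e [X in (X + _)%E](spectralT u) lte_add_pinfty// ltry.
Qed.

Lemma fcalc_domDB u w : fcalc_dom E f u -> fcalc_dom E f w ->
  fcalc_dom E f (u + w) /\ fcalc_dom E f (u - w).
Proof.
move=> du dw.
have f20 x : (0 <= (f x ^+ 2)%:E)%E by rewrite lee_fin sqr_ge0.
have := @ge0_integral_msum2 _ _ _ _ _ _ (spectral_parallelogram u w) _ f20 mf2.
rewrite !(@ge0_integral_measure_add _ _ _ _ _ setT)// => eq.
have : (\int[mu (u + w)%R]_x (f x ^+ 2)%:E + \int[mu (u - w)%R]_x (f x ^+ 2)%:E < +oo)%E.
  by rewrite eq; apply: lte_add_pinfty; apply: lte_add_pinfty.
by move=> h; split; apply: le_lt_trans h; [apply: leeDl|apply: leeDr];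
  apply: integral_ge0 => x _.
Qed.

Lemma fcalc_dom_pvm B u : measurable B -> fcalc_dom E f u -> fcalc_dom E f (E B u).
Proof.
move=> mB; apply: le_lt_trans; apply: ge0_le_measure_integral => //.
- move=> C mC; rewrite [leLHS](spectral_pvm u mB mC)//; apply: le_measure; rewrite ?inE//.
  exact: measurableI.
- by move=> x; rewrite lee_fin sqr_ge0.
Qed.

Lemma fcalc_dom_bounded B (M : R) u : measurable B ->
  (forall x, B x -> `|f x| <= M) -> fcalc_dom E f (E B u).
Proof.
move=> mB fM; rewrite /fcalc_dom/=.
have nB : mu (E B u) (~` B) = 0%E.
  rewrite spectral_pvm//; last exact: measurableC.
  by rewrite setICl measure0.
rewrite (@ge0_negligible_integral _ _ _ _ _ (~` B))//; last 2 first.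
- exact: measurableC.
- by move=> x _; rewrite lee_fin sqr_ge0.
rewrite setTD setCK.
apply: (@le_lt_trans _ _ (\int[mu (E B u)]_(x in B) (M ^+ 2)%:E)%E).
  apply: ge0_le_integral => //.
  - by move=> x _; rewrite lee_fin sqr_ge0.
  - exact: measurable_funS mf2.
  - move=> x Bx; rewrite lee_fin -(real_normK (num_real (f x))).
    by rewrite lerXn2r// ?nnegrE ?normr_ge0// ?(le_trans _ (fM _ Bx))// fM.
by rewrite integral_cst// /spectral_measure -EFinM ltry.
Qed.

(** The domain has enough test vectors: with [B n] the set where [|f| <= n], the vector
    [E (B n) (y - z)] lies in it, so [y - z] has no spectral mass on [B n], and these sets exhaust
    the line. *)
Lemma fcalc_inj u y z : fcalc E f u y -> fcalc E f u z -> y = z.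
Proof.
move=> [_ hy] [_ hz]; apply/eqP; rewrite -subr_eq0; set w := y - z.
pose B n := [set x : measurableTypeR R | `|f x| <= n%:R].
have mB n : measurable (B n).
  rewrite -[B n]setTI; apply: (@measurable_fun_le _ _ R setT (fun x => `|f x|) (cst n%:R)) => //.
  exact: measurableT_comp.
have B0 n : mu w (B n) = 0%E.
  have dw : fcalc_dom E f (E (B n) w) by apply: (@fcalc_dom_bounded _ n%:R).
  rewrite /spectral_measure (ip_norm ip) ip_pvm// ip_sym.
  by rewrite {1}/w ipDl ipNl hy// hz// subrr.
have : mu w (\bigcup_n B n) = 0%E.
  apply/eqP; rewrite eq_le measure_ge0 andbT.
  have := @measure_sigma_subadditive _ _ _ (mu w) (\bigcup_n B n) B mB
    (bigcup_measurable (fun n _ => mB n)) (fun x h => h).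
  by move/le_trans; apply; rewrite eseries0// => n _ _; exact: B0.
have -> : \bigcup_n B n = setT.
  rewrite -subTset => x _; exists (Num.bound `|f x|) => //=.
  by rewrite /B/=; apply/ltW/archi_boundP.
rewrite spectralT => -[/eqP]; rewrite expf_eq0/= normr_eq0//.
Qed.

End Dom.
End Pvm.

(** * Eigenvectors of A as atoms of the spectral measure *)

Section Eigen.
Context {R : realType} {H : completeNormedModType R} {ip : inner_product H}.
Variable E : pvm ip.
Local Notation mu := (spectral_measure E).

(** Equivalently, all the spectral mass of [e] sits at the point [m]. Eigenvectors are used in this
    form from here on, without reference to A. *)
Definition spectral_eigenvector (e : H) (m : R) :=
  forall B, measurable B -> E B e = \1_B m *: e.

Section FromCalculus.
Variables (e : H) (m : R).
Hypothesis eigen : fcalc E idfun e (m *: e).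

Let mid : measurable_fun setT (idfun : R -> R).
Proof. exact: measurable_id. Qed.

(* [e + w] and [e - w] with [w = E B e] have spectral measures
   [4 mu_w + mu_(e - w)] and [mu_(e - w)], so that the form at (e, w) is the
   integral of x against mu_w. *)
Lemma eigen_Rintegral B : measurable B ->
  Rintegral (mu (E B e)) setT idfun = m * `|E B e| ^+ 2.
Proof.
move=> mB; have [de fe] := eigen.
set w := E B e; pose w' := E (~` B) e; have mCB := measurableC mB.
have ew : e = w + w' by rewrite /w /w' pvm_add.
have dw : fcalc_dom E idfun w by exact: fcalc_dom_pvm.
have dw' : fcalc_dom E idfun w' by exact: fcalc_dom_pvm.
have [dp dm] := fcalc_domDB mid de dw.
have ii u : fcalc_dom E idfun u -> (mu u).-integrable setT (EFin \o idfun).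
  exact: fcalc_dom_integrable.
have h1 := Rintegral_msum2 (spectral_parallelogram E e w)
  (integrable_msum2 (fun C _ => measure_addE _ _ C) (ii _ de) (ii _ dw))
  (integrable_msum2 (fun C _ => measure_addE _ _ C) (ii _ de) (ii _ dw)).
rewrite !(Rintegral_msum2 (fun C _ => measure_addE _ _ C)) in h1; try exact: ii.
have orth C : measurable C -> mu (w + w') C = (mu w C + mu w' C)%E.
  move=> mC; apply: spectral_orth => //.
  have mI := measurableI _ _ mC mCB.
  rewrite pvm_sym// {1}/w pvm_sym// /w' -(pvm_setI E mC mCB) -(pvm_setI E mB mI).
  by rewrite setIA (setIC B) -setIA setICr setI0 pvm_set0 ip0r.
have h2 : Rintegral (mu e) setT idfun =
    Rintegral (mu w) setT idfun + Rintegral (mu w') setT idfun.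
  by rewrite {1}ew (Rintegral_msum2 orth)//; exact: ii.
have ew' : e - w = w' by rewrite {1}ew addrC addKr.
have := fe _ dw; rewrite ipZl {1}ew ipDl /fcalc_form ew'.
have -> : ip w' w = 0.
  by rewrite /w /w' pvm_sym// -pvm_setI// setICl pvm_set0 ip0r.
rewrite addr0 -(ip_norm ip) => ->.
rewrite ew' h2 in h1.
by rewrite -(addrK (Rintegral (mu w') setT idfun) (Rintegral (mu (e + w)) _ _)) h1; field.
Qed.

(** By [eigen_Rintegral] the function [s * (x - m)] has integral zero against the spectral measure
    of [E B e], which is carried by B, where the function is positive. The sign [s] covers both
    sides of [m]. *)
Lemma eigen_null (s : R) (B : set (measurableTypeR R)) :
  measurable B -> (forall x : R, B x -> 0 < s * (x - m)) ->
  E B e = 0.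
Proof.
move=> mB sB; set w := E B e.
have dw : fcalc_dom E idfun w by apply: fcalc_dom_pvm => //; exact: eigen.1.
have iw := fcalc_dom_integrable mid dw.
have mCB := measurableC mB.
have nB : mu w (~` B) = 0%E.
  by rewrite spectral_pvm// setICl measure0.
pose g (x : measurableTypeR R) := s * (x - m).
have gE : EFin \o g = (fun x => (s * x)%:E + (cst (- s * m)%:E) x)%E.
  by apply/funext => x; rewrite /g /= -EFinD; congr EFin; ring.
have i1 : (mu w).-integrable setT (fun x => (s * x)%:E).
  exact: (integrableZl measurableT s iw).
have i2 : (mu w).-integrable setT (cst (- s * m)%:E : _ -> \bar R).
  apply/integrableP; split => //.
  rewrite (eq_integral (cst `|(- s * m)%:E|%E))// integral_cst//.
  by rewrite [X in (_ * X)%E](spectralT E w) ltry.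
have ig : (mu w).-integrable setT (EFin \o g) by rewrite gE; exact: integrableD.
have g0 : (\int[mu w]_x (EFin \o g) x = 0)%E.
  have h : Rintegral (mu w) setT (fun x => s * x) = s * (m * `|w| ^+ 2).
    rewrite RintegralZl//; congr (_ * _); exact: eigen_Rintegral.
  rewrite gE integralD//= integral_cst// [X in (_ + _ * X)%E](spectralT E w).
  have -> : (\int[mu w]_x (s * x)%:E = (s * (m * `|w| ^+ 2))%:E)%E.
    by rewrite -h /Rintegral fineK//; exact: integrable_fin_num.
  by rewrite -EFinM -EFinD; congr EFin; ring.
have mg := measurable_int _ ig.
have g0B : (\int[mu w]_(x in B) `|(EFin \o g) x| = 0)%E.
  move: g0; rewrite (negligible_integral mCB)// setTD setCK => <-.
  apply: eq_integral => x /[!inE] Bx /=.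
  by rewrite gtr0_norm// sB.
have mgB : measurable_fun B (EFin \o g) by exact: measurable_funS mg.
have [N [mN N0 subN]] := (ae_eq_integral_abs (mu w) mB mgB).1 g0B.
have : mu w setT = 0%E.
  apply/eqP; rewrite eq_le measure_ge0 andbT.
  have -> : setT = ~` B `|` B by rewrite setUC setUv.
  apply: le_trans (measureU2 _ _ _) _ => //.
  rewrite [X in (X + _)%E](_ : _ = 0%E)// add0e -N0.
  apply: le_measure; rewrite ?inE// => x Bx; apply: subN => /= /(_ Bx)[/eqP].
  by rewrite gt_eqF// sB.
by rewrite spectralT => -[/eqP]; rewrite expf_eq0/= normr_eq0 => /eqP.
Qed.

(** [eigen_null] with [s = -1] and [s = 1] clears the two half-lines beside [m], leaving only the
    atom. *)
Lemma fcalc_eigenvector : spectral_eigenvector e m.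
Proof.
have mm : measurable ([set m] : set (measurableTypeR R)) by exact: measurable_set1.
have mCm := measurableC mm.
have nm : E (~` [set m]) e = 0.
  have : mu e (~` [set m]) = 0%E.
    apply/eqP; rewrite eq_le measure_ge0 andbT.
    have -> : ~` [set m] = `]-oo, m[%classic `|` `]m, +oo[%classic.
      apply/seteqP; split => x /=; rewrite !in_itv/= andbT.
        by move/eqP; case: ltgtP => // _ _; [left|right].
      by move=> + xm; rewrite xm ltxx => -[].
    apply: le_trans (measureU2 _ _ _) _ => //; try exact: measurable_itv.
    have n1 : E `]-oo, m[%classic e = 0.
      apply: (@eigen_null (-1)) => [|x /=]; first exact: measurable_itv.
      by rewrite in_itv/= => xm; rewrite mulN1r opprB subr_gt0.
    have n2 : E `]m, +oo[%classic e = 0.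
      apply: (@eigen_null 1) => [|x /=]; first exact: measurable_itv.
      by rewrite in_itv/= andbT => xm; rewrite mul1r subr_gt0.
    by rewrite /= /spectral_measure n1 n2 !normr0 expr0n adde0.
  by move=> -[/eqP]; rewrite expf_eq0/= normr_eq0 => /eqP.
move=> B mB; have mCB := measurableC mB; rewrite indicE; have [mBm|mBm] := boolP (m \in B).
  have : E (~` B) e = 0.
    have -> : ~` B = ~` B `&` ~` [set m].
      rewrite setIidl// => x Bx /= xm; apply: Bx; rewrite xm; exact/set_mem.
    by rewrite pvm_setI// nm pvm0.
  by move=> nB; have := pvm_add E e mB; rewrite nB addr0 scale1r.
have -> : B = B `&` ~` [set m].
  by rewrite setIidl// => x Bx /= xm; move/negP: mBm; apply; rewrite inE -xm.
by rewrite pvm_setI// nm pvm0// scale0r.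
Qed.

End FromCalculus.
End Eigen.

(** * Functional calculus of nonnegative functions by simple approximation *)

Section SimpleCalculus.
Import HBNNSimple finmap.
Context {R : realType} {H : completeNormedModType R} {ip : inner_product H}.
Variable E : pvm ip.
Local Notation mu := (spectral_measure E).
Local Notation sfun := {nnsfun measurableTypeR R >-> R}.
Implicit Types (g h : sfun) (u v w : H).

Definition srange g : seq R := fset_set (range g).

Definition sapply g u : H := \sum_(x <- srange g) x *: E (g @^-1` [set x]) u.

Let mlev g (x : R) : measurable (g @^-1` [set x]).
Proof. exact: measurable_funPTI. Qed.

Lemma mem_srange g t : g t \in srange g.
Proof. by rewrite /srange in_fset_set//; apply/mem_set; exists t. Qed.

Lemma srange_uniq g : uniq (srange g).
Proof. exact: fset_uniq. Qed.

Lemma integral_simple (k : R -> R) g v : (forall x, 0 <= x -> 0 <= k x) ->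
  (\int[mu v]_t (k (g t))%:E =
   (\sum_(x <- srange g) k x * `|E (g @^-1` [set x]) v| ^+ 2)%:E)%E.
Proof.
move=> k0.
have kg0 x : x \in srange g -> 0 <= k x.
  by rewrite /srange in_fset_set// => /set_mem[t _ <-]; exact/k0.
(* The absolute value makes every summand nonnegative, also for an index [x] outside the range of
   [g], as exchanging sum and integral demands. *)
transitivity (\int[mu v]_t (\sum_(x <- srange g)
    (`|k x| * \1_(g @^-1` [set x]) t)%:E))%E.
  apply: eq_integral => t _; rewrite (bigD1_seq (g t)) ?mem_srange ?srange_uniq//=.
  rewrite indicE mem_set//= mulr1 ger0_norm ?kg0 ?mem_srange//.
  rewrite big1 ?adde0// => x xg; rewrite indicE memNset ?mulr0//= => /eqP.
  by rewrite eq_sym (negbTE xg).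
have m1 x : measurable_fun setT
    (fun t : measurableTypeR R => (`|k x| * \1_(g @^-1` [set x]) t)%:E).
  by apply/measurable_EFinP; exact: measurable_funM.
have p1 x (t : measurableTypeR R) : setT t -> (0 <= (`|k x| * \1_(g @^-1` [set x]) t)%:E)%E.
  by move=> _; rewrite lee_fin mulr_ge0.
rewrite (ge0_integral_sum _ _ m1 p1)//.
rewrite -sumEFin big_seq [RHS]big_seq; apply: eq_bigr => x xg.
rewrite (@integralZl_indic _ _ _ _ setT measurableT (fun _ => g @^-1` [set x]))//; last first.
  by rewrite ltNge normr_ge0.
by rewrite integral_indic// setIT EFinM ger0_norm// kg0.
Qed.

Lemma ip_sapply g u w : ip (sapply g u) w =
  \sum_(x <- srange g) x * ip (E (g @^-1` [set x]) u) w.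
Proof. by rewrite ip_suml; apply: eq_bigr => x _; rewrite ipZl. Qed.

Lemma ip_sapply_form g u w : ip (sapply g u) w = fcalc_form E g u w.
Proof.
rewrite /fcalc_form /Rintegral !(@integral_simple idfun)//= ip_sapply -sumrB mulr_sumr.
apply: eq_bigr => x _; rewrite -mulrBr mulrCA; congr (_ * _).
by rewrite pvmB// pvmD// -(ip_polar ip) ip_pvm.
Qed.

Lemma ip_pvm2 B C u : measurable B -> measurable C ->
  ip (E B u) (E C u) = `|E B (E C u)| ^+ 2.
Proof.
move=> mB mC; rewrite (ip_norm ip) ip_pvm// -pvm_setI// setIC pvm_setI//.
by rewrite ip_pvm// -pvm_sym.
Qed.

Lemma sum_pvm g v : \sum_(x <- srange g) `|E (g @^-1` [set x]) v| ^+ 2 = `|v| ^+ 2.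
Proof.
have := @integral_simple (cst 1) g v (fun _ _ => ler01).
have -> : (\int[mu v]_t (cst 1 (g t) : R)%:E = (`|v| ^+ 2)%:E)%E.
  by rewrite (eq_integral (cst 1%:E))// integral_cst// mul1e; exact: spectralT.
move=> -[->].
by apply: eq_bigr => x _; rewrite mul1r.
Qed.

Lemma norm_sapply g u :
  ((`|sapply g u| ^+ 2)%:E = \int[mu u]_t (g t ^+ 2)%:E)%E.
Proof.
rewrite (@integral_simple (fun x => x ^+ 2))//; last by move=> x _; rewrite sqr_ge0.
congr EFin; rewrite (ip_norm ip) ip_sapply big_seq [RHS]big_seq.
apply: eq_bigr => x xg; rewrite expr2 -mulrA; congr (_ * _).
rewrite ip_sym ip_sapply (bigD1_seq x) ?srange_uniq//= big1 ?addr0.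
  by rewrite -(ip_norm ip).
move=> y yx; rewrite ip_pvm2// pvm_disj ?normr0 ?expr0n ?mulr0//.
by apply/seteqP; split => t //= [-> xy]; move: yx; rewrite xy eqxx.
Qed.

(** Split along the level sets of both functions: the inner product is a sum of [x * y] times
    squared norms, and only pairs of level sets that meet contribute. For these [x <= y]. *)
Lemma le_sapply g h u : (forall t, g t <= h t) ->
  `|sapply g u| ^+ 2 <= ip (sapply h u) (sapply g u).
Proof.
move=> gh; rewrite -lee_fin norm_sapply (@integral_simple (fun x => x ^+ 2))//; last first.
  by move=> x _; rewrite sqr_ge0.
rewrite lee_fin ip_sym ip_sapply; rewrite big_seq [leRHS]big_seq; apply: ler_sum => x xg.
have x0 : 0 <= x by move: xg; rewrite /srange in_fset_set// => /set_mem[t _ <-].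
rewrite -(sum_pvm h) expr2 -mulrA ler_wpM2l// ip_sym ip_sapply mulr_sumr.
apply: ler_sum => y _; rewrite ip_pvm2//.
have [e0|/set0P[t [/= hy gx]]] := eqVneq (h @^-1` [set y] `&` g @^-1` [set x]) set0; last first.
  by rewrite ler_wpM2r ?sqr_ge0// -hy -gx.
rewrite pvm_disj// normr0 expr0n !mulr0//.
Qed.

Lemma norm_sapplyB g h u : (forall t, g t <= h t) ->
  `|sapply h u - sapply g u| ^+ 2 <= `|sapply h u| ^+ 2 - `|sapply g u| ^+ 2.
Proof. by move=> gh; rewrite (normB_sqr ip); have := le_sapply u gh; lra. Qed.

Lemma ip_sapply_eigen g u e m : spectral_eigenvector E e m ->
  ip (sapply g u) e = g m * ip u e.
Proof.
move=> eP; rewrite ip_sapply (bigD1_seq (g m)) ?mem_srange ?srange_uniq//=.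
rewrite pvm_sym// eP// indicE mem_set// scale1r big1 ?addr0// => x xg.
rewrite pvm_sym// eP// indicE memNset ?scale0r ?ip0r ?mulr0//= => /eqP.
by rewrite eq_sym (negbTE xg).
Qed.

Section Existence.
Variable f : R -> R.
Hypotheses (mf : measurable_fun setT f) (f0 : forall x, 0 <= f x).

Let mF : measurable_fun (setT : set (measurableTypeR R)) (EFin \o f).
Proof. exact/measurable_EFinP. Qed.

Let g_ := nnsfun_approx (measurableT : measurable (setT : set (measurableTypeR R))) mF.

Let g_nd n m t : (n <= m)%N -> g_ n t <= g_ m t.
Proof. by move=> nm; have /lefP := nd_nnsfun_approx measurableT mF nm; exact. Qed.

Let g_cvg t : (g_ n t)%:E @[n --> \oo] --> (f t)%:E.
Proof. by apply: cvg_nnsfun_approx => // x _; rewrite lee_fin. Qed.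

Let g_cvgR t : g_ n t @[n --> \oo] --> f t.
Proof. by have /fine_cvgP[_] := @g_cvg t. Qed.


Let cvg_int1 v : (\int[mu v]_t (g_ n t)%:E @[n --> \oo] --> \int[mu v]_t (f t)%:E)%E.
Proof.
rewrite [X in _ --> X](_ : _ = \int[mu v]_t limn (fun n => (g_ n t)%:E))%E; last first.
  by apply: eq_integral => t _; apply/esym/cvg_lim.
apply: cvg_monotone_convergence => //.
- by move=> n; apply/measurable_EFinP.
- by move=> n t _; rewrite lee_fin.
- by move=> t _ n m nm; rewrite lee_fin g_nd.
Qed.

Let cvg_int2 v : (\int[mu v]_t (g_ n t ^+ 2)%:E @[n --> \oo] --> \int[mu v]_t (f t ^+ 2)%:E)%E.
Proof.
rewrite [X in _ --> X](_ : _ = \int[mu v]_t limn (fun n => (g_ n t ^+ 2)%:E))%E; last first.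
  apply: eq_integral => t _; apply/esym/cvg_lim => //.
  apply: cvg_EFin; first exact: nearW.
  rewrite (_ : fine \o _ = (fun n => g_ n t * g_ n t)); last first.
    by apply/funext => n /=; rewrite expr2.
  by rewrite expr2; apply: cvgM; exact: g_cvgR.
apply: cvg_monotone_convergence => //.
- by move=> n; apply/measurable_EFinP; exact: measurable_funX.
- by move=> n t _; rewrite lee_fin sqr_ge0.
- by move=> t _ n m nm; rewrite lee_fin lerXn2r// ?nnegrE// g_nd.
Qed.

(* For simple functions increasing to f, [norm_sapplyB] bounds the squared
   distances by the increments of a convergent sequence of norms. *)
Lemma fcalc_exists u : fcalc_dom E f u -> exists y,
  [/\ fcalc E f u y, ((`|y| ^+ 2)%:E = \int[mu u]_t (f t ^+ 2)%:E)%E &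
      forall e m, spectral_eigenvector E e m -> ip y e = f m * ip u e].
Proof.
move=> du; pose y_ n := sapply (g_ n) u.
have fin2 : (\int[mu u]_t (f t ^+ 2)%:E)%E \is a fin_num.
  rewrite ge0_fin_numE//; apply: integral_ge0 => t _; by rewrite lee_fin sqr_ge0.
pose a := fine (\int[mu u]_t (f t ^+ 2)%:E)%E.
have na : `|y_ n| ^+ 2 @[n --> \oo] --> a.
  have := cvg_int2 (v := u); under eq_cvg do rewrite -norm_sapply.
  by rewrite -(fineK fin2) => /fine_cvgP[_].
have : cvgn y_.
  apply/cauchy_cvgP/cauchy_exP => e e0.
  have e20 : 0 < e ^+ 2 / 2 by rewrite divr_gt0// exprn_gt0.
  have [N _ hN] := (cvgrPdist_lt _ _).1 na _ e20.
  exists (y_ N), N => // n /= Nn; rewrite -ball_normE/= distrC.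
  rewrite -(@ltr_pXn2r _ 2)// ?nnegrE// ?(ltW e0)//.
  apply: le_lt_trans (norm_sapplyB u (fun t => g_nd t Nn)) _.
  have := hN _ (leqnn N); have := hN _ Nn; rewrite !ltr_norml => /andP[h1 _] /andP[_ h2].
  by rewrite -/(y_ n) -/(y_ N); lra.
move=> /cvg_ex[y yy]; exists y; split.
- split=> // w dw; have [dp dm] := fcalc_domDB mf du dw.
  have h : ip (y_ n) w @[n --> \oo] --> ip y w by exact: cvg_ipl.
  apply: (cvg_unique _ h) => //.
  have cR v : fcalc_dom E f v ->
      Rintegral (mu v) setT (g_ n) @[n --> \oo] --> Rintegral (mu v) setT f.
    move=> dv; have := @cvg_int1 v; have := fcalc_dom_integrable mf dv.
    by move=> /integrable_fin_num fv; rewrite -(fineK (fv measurableT)) => /fine_cvgP[_].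
  have -> : (fun n => ip (y_ n) w) = (fun n => fcalc_form E (g_ n) u w).
    by apply/funext => n; exact: ip_sapply_form.
  by apply: cvgMr; apply: cvgB; exact: cR.
- have h : `|y_ n| ^+ 2 @[n --> \oo] --> `|y| ^+ 2.
    by rewrite expr2; under eq_cvg do rewrite expr2; apply: cvgM; exact: cvg_norm.
  by rewrite -(fineK fin2) -/a -(cvg_unique _ na h).
- move=> e m eP; have h : ip (y_ n) e @[n --> \oo] --> ip y e by exact: cvg_ipl.
  apply: (cvg_unique _ h) => //; 
  have -> : (fun n => ip (y_ n) e) = (fun n => g_ n m * ip u e).
    by apply/funext => n; exact: ip_sapply_eigen.
  by apply: cvgMl; exact: g_cvgR.
Qed.

End Existence.
End SimpleCalculus.

Section NonnegSeries.
Context {R : realType}.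
Implicit Types a : nat -> R.

Lemma nneseries_EFin_cvg a l : (forall k, 0 <= a k) ->
  series a @ \oo --> l -> (\sum_(k <oo) (a k)%:E = l%:E)%E.
Proof.
move=> a0 al; apply/cvg_lim => //.
apply: cvg_EFin; first by apply: nearW => n; rewrite sumEFin.
by rewrite (_ : fine \o _ = series a)//; apply/funext => n /=; rewrite sumEFin.
Qed.

Lemma nneseries_fin_cvg a : (forall k, 0 <= a k) ->
  (\sum_(k <oo) (a k)%:E < +oo)%E -> cvgn (series a).
Proof.
move=> a0 h; apply: nondecreasing_is_cvgn.
  by apply/nondecreasing_seqP => n; rewrite !seriesEnat/= big_nat_recr//= lerDl.
exists (fine (\sum_(k <oo) (a k)%:E)%E) => _ [n _ <-].
rewrite -lee_fin fineK; last first.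
  by rewrite ge0_fin_numE// nneseries_ge0// => k _ _; rewrite lee_fin.
rewrite seriesEnat/= -sumEFin; apply: nneseries_lim_ge => k _ _; by rewrite lee_fin.
Qed.

End NonnegSeries.

Section PowerOperator.
Context {R : realType} {H : completeNormedModType R} {ip : inner_product H}.
Variable E : pvm ip.

(** The choice inside [op_pow] is harmless: a value exists by [fcalc_exists] and is unique by
    [fcalc_inj], so it has the norm and the coefficients of the constructed one. *)
Lemma op_powP b w : pow_dom E b w ->
  ((`|op_pow E b w| ^+ 2)%:E = \int[spectral_measure E w]_t ((t `^ b) ^+ 2)%:E)%E /\
  forall e m, spectral_eigenvector E e m -> ip (op_pow E b w) e = m `^ b * ip w e.
Proof.
move=> dw; have mp := @measurable_powR R b.
have [y [fy ny ey]] := fcalc_exists mp (fun x => powR_ge0 x b) dw.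
suff -> : op_pow E b w = y by [].
have yP : fcalc E (fun x => x `^ b) w (op_pow E b w) by exact: (xgetPex 0 (ex_intro _ y fy)).
exact: fcalc_inj mp w _ _ yP fy.
Qed.

Lemma dual_norm_le b (l : H -> R) (M : R) : 0 <= M ->
  (forall w, pow_dom E b w -> `|l w| <= M * `|op_pow E b w|) ->
  (dual_norm E b l <= M%:E)%E.
Proof.
move=> M0 lM; apply: ub_ereal_sup => _ [w [dw gw] <-]; rewrite lee_fin.
apply: le_trans (lM _ dw) _; rewrite ler_piMr//.
apply: le_trans gw; rewrite /graph_norm -[leLHS]ger0_norm// -sqrtr_sqr.
by rewrite ler_wsqrtr// lerDr sqr_ge0.
Qed.

End PowerOperator.

(** * Powers and spectral integrals on sums of eigenvectors *)

Section SpectralSynthesis.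
Context {R : realType} {H : completeNormedModType R} {ip : inner_product H}.
Variables (E : pvm ip) (f : nat -> H) (m : nat -> R).
Hypothesis f_orthonormal : forall i j, ip (f i) (f j) = (i == j)%:R.
Hypothesis f_eigen : forall k, spectral_eigenvector E (f k) (m k).
Implicit Types (a d z : nat -> R).
Local Notation mu := (spectral_measure E).
Local Notation synth := (synth f).

Lemma pvm_synth a B : ell2 a -> measurable B ->
  E B (synth a) = synth (fun k => \1_B (m k) * a k).
Proof.
move=> la mB; apply/esym/cvg_lim => //.
have := @pvm_cvg _ _ _ E B mB _ _ (synth_cvg f_orthonormal la); apply: cvg_trans.
rewrite (_ : (fun n => E B _) = series (fun k => (\1_B (m k) * a k) *: f k))//.
apply/funext => n; rewrite /series/= pvm_sum//; apply: eq_bigr => k _.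
by rewrite pvmZ// f_eigen// scalerA mulrC.
Qed.

(** The spectral measure of [synth a] is the sum of the point masses [a k ^+ 2] at [m k]. *)
Lemma integral_synth a (h : measurableTypeR R -> \bar R) : ell2 a ->
  (forall x, (0 <= h x)%E) -> measurable_fun setT h ->
  (\int[mu (synth a)]_x h x = \sum_(k <oo) (a k ^+ 2)%:E * h (m k))%E.
Proof.
move=> la h0 mh.
pose w k : {nonneg R} := NngNum (sqr_ge0 (a k)).
pose mk k : {measure set (measurableTypeR R) -> \bar R} := mscale (w k) (dirac (m k : measurableTypeR R)).
rewrite (eq_measure_integral (mseries mk 0)); last first.
  move=> B mB _ /=; rewrite /spectral_measure pvm_synth//.
  have lB : ell2 (fun k => \1_B (m k) * a k).
    apply: ell2_le la => k; rewrite indicE normrM.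
    by case: (_ \in _); rewrite ?normr1 ?mul1r// normr0 mul0r.
  rewrite /mseries -(nneseries_EFin_cvg _ (norm_synth f_orthonormal lB)); last first.
    by move=> k; rewrite sqr_ge0.
  apply: eq_eseriesr => k _.
  transitivity ((a k ^+ 2)%:E * (\1_B (m k))%:E)%E; last by [].
  by rewrite indicE; case: (_ \in _); rewrite ?mul1r ?mule1// mul0r expr0n mule0.
rewrite ge0_integral_measure_series//; apply: eq_eseriesr => k _.
by rewrite ge0_integral_mscale// integral_dirac// diracT mul1e.
Qed.

Lemma pow_dom_synth b a : ell2 a ->
  pow_dom E b (synth a) <-> ell2 (fun k => m k `^ b * a k).
Proof.
move=> la; rewrite /pow_dom /fcalc_dom /= integral_synth//; last 2 first.
- by move=> x; rewrite lee_fin sqr_ge0.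
- by apply/measurable_EFinP/measurable_funX; exact: measurable_powR.
have -> : (fun n => \sum_(0 <= k < n) (a k ^+ 2)%:E * ((m k `^ b) ^+ 2)%:E)%E =
    (fun n => \sum_(0 <= k < n) ((m k `^ b * a k) ^+ 2)%:E)%E.
  apply/funext => n; apply: eq_bigr => k _; rewrite -EFinM; congr EFin; ring.
have s0 k : 0 <= (m k `^ b * a k) ^+ 2 by rewrite sqr_ge0.
split; first exact: nneseries_fin_cvg.
by move=> /cvg_ex[l /(nneseries_EFin_cvg s0) ->]; rewrite ltry.
Qed.

(** Equal coefficients alone would not identify the two vectors, since [f] need not be complete and
    the left-hand side might have a component orthogonal to it. Equality of the norms excludes this:
    together they give [|z - y| = 0]. *)
Lemma op_pow_synth b a : ell2 a -> ell2 (fun k => m k `^ b * a k) ->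
  op_pow E b (synth a) = synth (fun k => m k `^ b * a k).
Proof.
move=> la lb; have [ny ey] := op_powP ((pow_dom_synth b la).2 lb).
set y := op_pow _ _ _ in ny ey *; set z := synth _.
have yz : `|y| ^+ 2 = `|z| ^+ 2.
  apply: EFin_inj; rewrite ny integral_synth//; last 2 first.
  - by move=> x; rewrite lee_fin sqr_ge0.
  - by apply/measurable_EFinP/measurable_funX; exact: measurable_powR.
  rewrite -(@nneseries_EFin_cvg _ _ _ _ (norm_synth f_orthonormal lb)); last first.
    by move=> k; rewrite sqr_ge0.
  by apply: eq_eseriesr => k _; rewrite -EFinM; congr EFin; ring.
have zy : ip z y = `|z| ^+ 2.
  apply: (cvg_unique _ (ip_synthl f_orthonormal (w := y) lb)) => //.
  have := norm_synth f_orthonormal lb.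
  rewrite (_ : (fun k => _ ^+ 2) = (fun k => m k `^ b * a k * ip (f k) y))//.
  apply/funext => k; rewrite expr2; congr (_ * _).
  by rewrite ip_sym (ey _ _ (f_eigen k)) synth_coef.
apply/eqP; rewrite -subr_eq0 -normr_eq0 -sqrf_eq0 (normB_sqr ip) ip_sym zy yz.
by apply/eqP; ring.
Qed.

Lemma graph_norm_synth b a : ell2 a -> ell2 (fun k => m k `^ b * a k) ->
  graph_norm E b (synth a) =
  Num.sqrt (`|synth a| ^+ 2 + `|synth (fun k => m k `^ b * a k)| ^+ 2).
Proof. by move=> la lb; rewrite /graph_norm op_pow_synth. Qed.

(* The functional [<synth d, .> + c A (synth a)] on D(A^(1/4)) is
   [<synth z, A^(1/4) .>], hence its dual norm is at most the norm of [synth z]. *)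
Lemma op_dual_synth a d z (c : R) w : ell2 a -> ell2 d -> ell2 z ->
  ell2 (fun k => m k `^ (3 / 4) * a k) ->
  (forall k, d k + c * (m k `^ (3 / 4) * m k `^ (1 / 4) * a k) = m k `^ (1 / 4) * z k) ->
  pow_dom E (1 / 4) w ->
  ip (synth d) w + c * op_dual E (synth a) w = ip (synth z) (op_pow E (1 / 4) w).
Proof.
move=> la ld lz l3 dz dw; have [_ ew] := op_powP dw.
rewrite /op_dual op_pow_synth//; set y := op_pow E _ w in ew *.
apply/esym; apply: (cvg_unique _ (ip_synthl f_orthonormal (w := y) lz)) => //.
have cd := ip_synthl f_orthonormal (w := w) ld.
have c3 := ip_synthl f_orthonormal (w := y) l3.
rewrite (_ : series _ = (fun n => series (fun k => d k * ip (f k) w) n +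
   c * series (fun k => m k `^ (3 / 4) * a k * ip (f k) y) n)).
  by apply: cvgD => //; exact: cvgMr.
apply/funext => n; rewrite /series/= mulr_sumr -big_split; apply: eq_bigr => k _ /=.
have -> : ip (f k) y = m k `^ (1 / 4) * ip (f k) w by rewrite ip_sym (ew _ _ (f_eigen k)) ip_sym.
rewrite mulrCA mulrA -dz; ring.
Qed.

(** As [phi] may fail to be measurable, the weight is replaced by a function equal to it at the
    points [m k] and to 0 elsewhere; the complement of these points is null. Injectivity of [m]
    leaves a single nonzero term of [g] at each of them. *)
Lemma gevrey_synth phi r b a : injective m -> ell2 a ->
  cvgn (series (fun k => a k ^+ 2 *
    (Num.sqrt (m k) `^ (4 * b) * expR (r * phi (Num.sqrt (m k)))))) ->
  gevrey E phi r b (synth a).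
Proof.
set F := (fun x => Num.sqrt x `^ (4 * b) * expR (r * phi (Num.sqrt x))).
move=> mi la cF; pose h k : measurableTypeR R -> \bar R := fun x => (F (m k) * \1_[set m k] x)%:E.
have F0 x : 0 <= F x by rewrite mulr_ge0 ?powR_ge0 ?expR_ge0.
have h0 k x : (0 <= h k x)%E by rewrite lee_fin mulr_ge0.
have m1 k : measurable ([set m k] : set (measurableTypeR R)) by exact: measurable_set1.
pose g (x : measurableTypeR R) := (\sum_(k <oo) h k x)%E.
have mg : measurable_fun setT g.
  apply: ge0_emeasurable_sum => // k _; apply/measurable_EFinP.
  exact: measurable_funM.
have gm k : g (m k) = (F (m k))%:E.
  rewrite /g (nneseriesD1 (n := k))// /h indicE mem_set//= mulr1.
  rewrite eseries0 ?adde0// => i _ ik; rewrite indicE memNset ?mulr0// => /= /mi ki.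
  by rewrite ki eqxx in ik.
exists g; split => //.
- pose S := \bigcup_k [set m k] : set (measurableTypeR R).
  have mS : measurable S by exact: bigcup_measurable.
  exists (~` S); split; first exact: measurableC.
    rewrite /= /spectral_measure pvm_synth//; last exact: measurableC.
    rewrite (_ : (fun k => _) = fun=> 0).
      rewrite (_ : synth _ = 0) ?normr0 ?expr0n//.
      apply/cvg_lim => //; rewrite (_ : series _ = cst 0); first exact: cvg_cst.
      by apply/funext => n; rewrite /series/= big1// => i _; rewrite scale0r.
    apply/funext => k; rewrite indicE memNset ?mul0r//=.
    by apply; exists k.
  by move=> x /= + Sx; apply; case: Sx => k _ ->; rewrite gm.
- rewrite integral_synth//; last by move=> x; apply: nneseries_ge0.
  under eq_eseriesr do rewrite gm -EFinM.
  move/cvg_ex : cF => [l /nneseries_EFin_cvg -> //]; first by rewrite ltry.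
  by move=> k; rewrite mulr_ge0// sqr_ge0.
Qed.

End SpectralSynthesis.

(** * Calculus on the real line *)

Section Calculus.
Context {R : realType}.
Implicit Types (f g df : R -> R) (x a b : R).

Lemma is_derive_pD x f g a b : is_derive x 1 f a -> is_derive x 1 g b ->
  is_derive x 1 (fun t => f t + g t) (a + b).
Proof. by move=> hf hg; exact: is_deriveD. Qed.

Lemma is_derive_pN x f a : is_derive x 1 f a -> is_derive x 1 (fun t => - f t) (- a).
Proof. by move=> hf; exact: is_deriveN. Qed.

Lemma is_derive_pB x f g a b : is_derive x 1 f a -> is_derive x 1 g b ->
  is_derive x 1 (fun t => f t - g t) (a - b).
Proof. by move=> hf hg; exact: is_deriveB. Qed.

Lemma is_derive_pM x f g a b : is_derive x 1 f a -> is_derive x 1 g b ->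
  is_derive x 1 (fun t => f t * g t) (a * g x + f x * b).
Proof.
move=> hf hg; apply: (is_derive_eq (is_deriveM hf hg)).
by rewrite /GRing.scale/=; ring.
Qed.

Lemma is_derive_pcomp x f g a b : is_derive x 1 f a -> is_derive (f x) 1 g b ->
  is_derive x 1 (fun t => g (f t)) (b * a).
Proof. by move=> hf hg; exact: (is_derive1_comp hg hf). Qed.

Lemma is_derive_pcst x a : is_derive x 1 (fun=> a) 0.
Proof. exact: is_derive_cst. Qed.

Lemma is_derive_pid x : is_derive x 1 (fun t => t) 1.
Proof. exact: is_derive_id. Qed.

Lemma is_derive_pZ x f a b : is_derive x 1 f a -> is_derive x 1 (fun t => b * f t) (b * a).
Proof.
move=> hf; apply: (is_derive_eq (is_derive_pM (is_derive_pcst x b) hf)).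
by rewrite mul0r add0r.
Qed.

Lemma is_derive_pexp x f a : is_derive x 1 f a ->
  is_derive x 1 (fun t => expR (f t)) (a * expR (f x)).
Proof.
by move=> hf; rewrite mulrC; apply: (is_derive_pcomp hf); exact: is_derive_expR.
Qed.

Lemma is_derive_psin x f a : is_derive x 1 f a ->
  is_derive x 1 (fun t => sin (f t)) (a * cos (f x)).
Proof.
by move=> hf; rewrite mulrC; apply: (is_derive_pcomp hf); exact: is_derive_sin.
Qed.

Lemma is_derive_pcos x f a : is_derive x 1 f a ->
  is_derive x 1 (fun t => cos (f t)) (- a * sin (f x)).
Proof.
move=> hf; rewrite mulNr -mulrN mulrC; apply: (is_derive_pcomp hf); exact: is_derive_cos.
Qed.

Lemma is_derive_continuous x f a : is_derive x 1 f a -> {for x, continuous f}.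
Proof. by move=> [df _]; apply/differentiable_continuous/derivable1_diffP. Qed.

Lemma is_derive_within f df a b :
  (forall x, a <= x <= b -> is_derive x 1 f (df x)) ->
  {within `[a, b], continuous f}.
Proof.
move=> h; apply: derivable_within_continuous => x; rewrite in_itv/= => /h[].
by [].
Qed.

Lemma MVT_is_derive f df a b : a <= b ->
  (forall x, a <= x <= b -> is_derive x 1 f (df x)) ->
  exists2 c, a <= c <= b & f b - f a = df c * (b - a).
Proof.
move=> ab h; have [|c + ->] := @MVT_segment _ f df _ _ ab _ (is_derive_within h).
  by move=> x; rewrite in_itv/= => /andP[ax xb]; apply: h; rewrite !ltW.
by rewrite in_itv/=; exists c.
Qed.

Lemma is_derive_nondecreasing f df a b : a <= b ->
  (forall x, a <= x <= b -> is_derive x 1 f (df x)) ->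
  (forall x, a <= x <= b -> 0 <= df x) -> f a <= f b.
Proof.
move=> ab h df0; have [c cab e] := MVT_is_derive ab h.
by rewrite -subr_ge0 e mulr_ge0 ?df0// subr_ge0.
Qed.

Lemma is_derive_lipschitz f df (M : R) a b :
  (forall x, Num.min a b <= x <= Num.max a b -> is_derive x 1 f (df x)) ->
  (forall x, Num.min a b <= x <= Num.max a b -> `|df x| <= M) ->
  `|f a - f b| <= M * `|a - b|.
Proof.
wlog ab : a b / a <= b.
  move=> hw; have /orP[ab|ba] := le_total a b; first exact: hw.
  by move=> h1 h2; rewrite distrC (distrC a); apply: hw => //; rewrite minC maxC.
rewrite (min_idPl ab) (max_idPr ab) => h hM.
have [c cab e] := MVT_is_derive ab h.
by rewrite distrC e normrM distrC ler_wpM2r// hM.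
Qed.

Lemma gronwall f df (K : R) a b : a <= b ->
  (forall x, a <= x <= b -> is_derive x 1 f (df x)) ->
  (forall x, a <= x <= b -> `|df x| <= K * f x) ->
  f b <= f a * expR (K * (b - a)) /\ f a <= f b * expR (K * (b - a)).
Proof.
move=> ab h hK.
(* The product is nondecreasing for [s = K] and nonincreasing for [s = - K], which gives the two
   inequalities. *)
have key (s : R) x : a <= x <= b -> is_derive x 1 (fun t => f t * expR (s * t))
    ((df x + s * f x) * expR (s * x)).
  move=> xab; apply: (is_derive_eq (is_derive_pM (h x xab)
    (is_derive_pexp (is_derive_pZ s (is_derive_pid x))))).
  by rewrite mulr1; ring.
have up : f a * expR (K * a) <= f b * expR (K * b).
  apply: (is_derive_nondecreasing ab (key K)) => x xab.
  rewrite mulr_ge0 ?expR_ge0//.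
  by have := hK _ xab; rewrite ler_norml => /andP[]; lra.
have dn : - (f a * expR (- K * a)) <= - (f b * expR (- K * b)).
  apply: (@is_derive_nondecreasing (fun t => - (f t * expR (- K * t)))
    (fun x => - ((df x + (- K) * f x) * expR (- K * x))) _ _ ab) => x xab.
    exact: is_derive_pN (key (- K) x xab).
  rewrite oppr_ge0 mulr_le0_ge0 ?expR_ge0//.
  by have := hK _ xab; rewrite ler_norml => /andP[]; lra.
split.
  rewrite -(@ler_pM2r _ (expR (- K * b))) ?expR_gt0// -mulrA -expRD.
  by rewrite (_ : K * (b - a) + - K * b = - K * a)//; [lra|ring].
rewrite -(@ler_pM2r _ (expR (K * a))) ?expR_gt0// -mulrA -expRD.
by rewrite (_ : K * (b - a) + K * a = K * b)//; ring.
Qed.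

End Calculus.

(** * Existence for linear oscillators *)

Section ODE.
Context {R : realType}.

Lemma primitive_exists (g : R -> R) : continuous g ->
  exists G : R -> R, G 0 = 0 /\ forall x : R, -1 < x -> is_derive x 1 G (g x).
Proof.
(* Integrating from -1 makes 0 an interior point, so that the two-sided derivative also exists
   there. *)
move=> cg; pose F x := (\int[@lebesgue_measure R]_(t in `[(-1), x]) (g t))%R.
exists (fun x => F x - F 0); split; first by rewrite subrr.
move=> x x1; have dF : is_derive x 1 F (g x).
  have [||dF F'] := @continuous_FTC1_closed R g (-1) x (x + 1) _ _ x1 (cg x).
  - by rewrite ltrDl.
  - apply: continuous_compact_integrable; first exact: segment_compact.
    exact: continuous_subspaceT.
  - by split; [exact: dF|rewrite -derive1E].
by apply: (is_derive_eq (is_derive_pB dF (is_derive_pcst x (F 0)))); rewrite subr0.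
Qed.

(* In the norm [sup |F x| exp (- m x)] integration has norm at most 1 / m: this
   makes the Picard operator a contraction on the whole half-line. *)
Lemma exp_bound (F df : R -> R) (C m : R) : 0 < m -> 0 <= C -> F 0 = 0 ->
  (forall x : R, 0 <= x -> is_derive x 1 F (df x)) ->
  (forall x : R, 0 <= x -> `|df x| <= C * expR (m * x)) ->
  forall x : R, 0 <= x -> `|F x| <= C / m * expR (m * x).
Proof.
move=> m0 C0 F0 dF bF x x0.
have dE (t : R) : is_derive t 1 (fun t => C / m * expR (m * t)) (C * expR (m * t)).
  apply: (is_derive_eq (is_derive_pZ (C / m) (is_derive_pexp (is_derive_pZ m (is_derive_pid t))))).
  by rewrite mulr1 mulrA divfK// gt_eqF.
have Cm : 0 <= C / m by rewrite divr_ge0// ltW.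
have key (s : bool) : 0 <= C / m * expR (m * x) - (-1) ^+ s * F x.
  pose G t := C / m * expR (m * t) - (-1) ^+ s * F t.
  have dG t : 0 <= t <= x -> is_derive t 1 G (C * expR (m * t) - (-1) ^+ s * df t).
    by move=> /andP[t0 _]; exact: is_derive_pB (dE t) (is_derive_pZ ((-1) ^+ s) (dF _ t0)).
  apply: (@le_trans _ _ (G 0)).
    by rewrite /G F0 !mulr0 expR0 mulr1 subr0.
  apply: (is_derive_nondecreasing x0 dG) => t /andP[t0 _].
  by have := bF _ t0; rewrite ler_norml => /andP[]; case: s {G dG} => /=; rewrite ?expr0 ?expr1; lra.
rewrite ler_norml; have := key true; have := key false; rewrite expr0 expr1.
by move=> h1 h2; apply/andP; split; lra.
Qed.

Section Picard.
Variables (q : R -> R) (Q a b : R).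
Hypotheses (cq : continuous q) (qQ : forall x, `|q x| <= Q).

(** The iterates are controlled on the half-line only. Composing with [pos] freezes them at their
    value at 0 and gives functions continuous on the whole line, as [primitive_exists] expects. *)
Let pos (x : R) : R := Num.max x 0.

Let pos_ge0 x : 0 <= pos x.
Proof. by rewrite /pos le_max lexx orbT. Qed.

Let posE x : 0 <= x -> pos x = x.
Proof. by move=> x0; rewrite /pos; apply/max_idPl. Qed.

Let cpos : continuous pos.
Proof. by move=> x; apply: (@continuous_max _ _ (fun t : R => t) (cst 0) x); [exact: cvg_id|exact: cvg_cst]. Qed.

Lemma picard_operator : exists K : (R -> R) -> (R -> R), exists K' : (R -> R) -> (R -> R),
  forall S, continuous (S \o pos) ->
   [/\ K S 0 = 0, K' S 0 = 0,
     forall x : R, 0 <= x -> is_derive x 1 (K S) (K' S x) &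
     forall x : R, 0 <= x -> is_derive x 1 (K' S) (- q x * S x)].
Proof.
(* A choice of primitives must be total: discontinuous functions receive an arbitrary one. *)
have [P hP] : {P : (R -> R) -> (R -> R) & forall g, continuous g ->
    P g 0 = 0 /\ forall x : R, -1 < x -> is_derive x 1 (P g) (g x)}.
  have ex g : exists G : R -> R, continuous g ->
      G 0 = 0 /\ forall x : R, -1 < x -> is_derive x 1 G (g x).
    have [/primitive_exists[G hG]|nc] := pselect (continuous g); first by exists G.
    by exists idfun => /nc.
  by exists (fun g => projT1 (cid (ex g))) => g; exact: (projT2 (cid (ex g))).
pose K' S := P (fun x => - q (pos x) * S (pos x)).
exists (fun S => P (fun x => K' S (pos x))), K' => S cS.
have c1 : continuous (fun x => - q (pos x) * S (pos x)).
  move=> x; apply: cvgM; last exact: cS.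
  by apply: cvgN; apply: continuous_comp; [exact: cpos|exact: cq].
have [K'0 dK'] := hP _ c1.
have m1 (x : R) : 0 <= x -> -1 < x by lra.
have c2 : continuous (fun x => K' S (pos x)).
  move=> x; apply: continuous_comp; first exact: cpos.
  by apply: is_derive_continuous (dK' _ _); exact/m1.
have [K0 dK] := hP _ c2; split => // x x0.
  by have := dK _ (m1 _ x0); rewrite posE.
by have := dK' _ (m1 _ x0); rewrite posE.
Qed.

Lemma ode_exists : exists u u' : R -> R,
  [/\ u 0 = a, u' 0 = b, forall x : R, 0 <= x -> is_derive x 1 u (u' x) &
      forall x : R, 0 <= x -> is_derive x 1 u' (- q x * u x)].
Proof.
have [K [K' KP]] := picard_operator.
have Q0 : 0 <= Q by apply: le_trans (qQ 0); exact: normr_ge0.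
(* The Picard operator multiplies by [q] and integrates twice, so its norm for the weight
   [expR (m * x)] is at most Q / m^2; this [m] brings it below 1/2. *)
pose m := 1 + Q; have m0 : 0 < m by rewrite /m; lra.
have mQ : Q / m / m <= 1 / 2.
  by rewrite -mulrA -invfM ler_pdivrMr ?mulr_gt0// /m; nra.
have KB (F F' df : R -> R) (C : R) : 0 <= C -> F 0 = 0 -> F' 0 = 0 ->
    (forall x : R, 0 <= x -> is_derive x 1 F (F' x)) ->
    (forall x : R, 0 <= x -> is_derive x 1 F' (- q x * df x)) ->
    (forall x : R, 0 <= x -> `|df x| <= C * expR (m * x)) ->
    forall x : R, 0 <= x -> `|F x| <= C / 2 * expR (m * x).
  move=> C0 F0 F'0 dF dF' bd x x0.
  have QC : 0 <= Q * C by rewrite mulr_ge0.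
  have b1 := @exp_bound F' (fun x => - q x * df x) (Q * C) m m0 QC F'0 dF'.
  have {}b1 : forall x : R, 0 <= x -> `|F' x| <= Q * C / m * expR (m * x).
    apply: b1 => t t0; rewrite normrM normrN -mulrA.
    by apply: ler_pM => //; exact: bd.
  have QCm : 0 <= Q * C / m by rewrite divr_ge0// ltW.
  have := @exp_bound F F' (Q * C / m) m m0 QCm F0 dF b1 x x0.
  move/le_trans; apply; rewrite ler_wpM2r ?expR_ge0//.
  rewrite (_ : Q * C / m / m = C * (Q / m / m)); last by field; rewrite gt_eqF.
  by rewrite ler_wpM2l// (le_trans mQ)// mul1r.
pose y0 (x : R) := a + b * x.
pose T S (x : R) := y0 x + K S x.
have dy0 (x : R) : is_derive x 1 y0 b.
  apply: (is_derive_eq (is_derive_pD (is_derive_pcst x a) (is_derive_pZ b (is_derive_pid x)))).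
  by rewrite add0r mulr1.
have cT S : continuous (S \o pos) -> continuous (T S \o pos).
  move=> /KP[_ _ dK _] x; apply: continuous_comp; first exact: cpos.
  apply: (@is_derive_continuous _ _ _ (b + K' S (pos x))).
  by apply: is_derive_pD (dy0 _) _; exact: dK.
pose S n := iter n T y0.
have cS n : continuous (S n \o pos).
  elim: n => [|n IH]; last exact: cT.
  by move=> x; apply: continuous_comp; [exact: cpos|exact: is_derive_continuous (dy0 _)].
have KBB (S1 S2 : R -> R) C : 0 <= C -> continuous (S1 \o pos) -> continuous (S2 \o pos) ->
    (forall x : R, 0 <= x -> `|S1 x - S2 x| <= C * expR (m * x)) ->
    forall x : R, 0 <= x -> `|K S1 x - K S2 x| <= C / 2 * expR (m * x).
  move=> C0 /KP[k10 k1'0 dk1 dk1'] /KP[k20 k2'0 dk2 dk2'].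
  apply: (@KB (fun x => K S1 x - K S2 x) (fun x => K' S1 x - K' S2 x)) => //.
  - by rewrite k10 k20 subrr.
  - by rewrite k1'0 k2'0 subrr.
  - by move=> x x0; apply: is_derive_pB; [exact: dk1|exact: dk2].
  - move=> x x0; apply: (is_derive_eq (is_derive_pB (dk1' x x0) (dk2' x x0))).
    ring.
pose C := `|a| + `|b|.
have C0 : 0 <= C by rewrite addr_ge0.
have y0C x : 0 <= x -> `|y0 x| <= C * expR (m * x).
  move=> x0; have e1 : 1 <= expR (m * x) by rewrite -[leLHS]expR0 ler_expR mulr_ge0 // ltW.
  have e2 : x <= expR (m * x).
    apply: (@le_trans _ _ (1 + m * x)); last exact: expR_ge1Dx.
    by rewrite /m; nra.
  rewrite /y0 /C mulrDl; apply: le_trans (ler_normD _ _) _; apply: lerD.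
    by rewrite ler_peMr.
  by rewrite normrM (ger0_norm x0) ler_wpM2l.
have dS n x : 0 <= x -> `|S n.+1 x - S n x| <= C * (1 / 2) ^+ n.+1 * expR (m * x).
  elim: n x => [|n IH] x x0.
    rewrite /S /= /T addrC addKr expr1 mul1r.
    have [k0 k'0 dk dk'] := KP _ (cS 0%N).
    exact: (@KB (K y0) (K' y0) y0).
  have -> : S n.+2 x - S n.+1 x = K (S n.+1) x - K (S n) x.
    by rewrite -[S n.+2 x]/(y0 x + K (S n.+1) x) -[X in _ - X]/(y0 x + K (S n) x); ring.
  have -> : C * (1 / 2) ^+ n.+2 = C * (1 / 2) ^+ n.+1 / 2 by rewrite exprSr; field.
  by apply: KBB => //; rewrite mulr_ge0// exprn_ge0//; lra.
have cau n k x : 0 <= x -> `|S (n + k)%N x - S n x| <= C * (1 / 2) ^+ n * expR (m * x).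
  move=> x0; set W := C * expR (m * x).
  have W0 : 0 <= W by rewrite mulr_ge0 ?expR_ge0.
  suff : `|S (n + k)%N x - S n x| <= W * ((1 / 2) ^+ n - (1 / 2) ^+ (n + k)).
    move/le_trans; apply; rewrite [leRHS]mulrAC -/W ler_wpM2l// gerBl exprn_ge0//.
  elim: k => [|k IH]; first by rewrite addn0 !subrr mulr0 normr0.
  rewrite addnS -(subrKA (S (n + k)%N x)).
  apply: le_trans (ler_normD _ _) _.
  have h := dS (n + k)%N x x0; rewrite mulrAC -/W exprS in h.
  have -> : W * ((1 / 2) ^+ n - (1 / 2) ^+ (n + k).+1) =
     W * ((1 / 2) * (1 / 2) ^+ (n + k)) + W * ((1 / 2) ^+ n - (1 / 2) ^+ (n + k)).
    by rewrite exprS; field.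
  exact: lerD.
have half0 (M e : R) : 0 < e -> 0 <= M -> exists n, M * (1 / 2) ^+ n < e.
  move=> e0 M0; have h : M * (1 / 2) ^+ n @[n --> \oo] --> M * 0.
    by apply: cvgMr; apply: cvg_expr; rewrite ger0_norm//; lra.
  rewrite mulr0 in h; have [N _ hN] := (cvgrPdist_lt _ _).1 h e e0.
  exists N; have := hN N (leqnn N); rewrite sub0r normrN ger0_norm//.
  by rewrite mulr_ge0// exprn_ge0.
have Scvg x : 0 <= x -> cvgn (fun n => S n x).
  move=> x0; apply/cauchy_cvgP/cauchy_exP => e e0.
  have [|N hN] := half0 (C * expR (m * x)) e e0; first by rewrite mulr_ge0 ?expR_ge0.
  exists (S N x), N => // n /= Nn; rewrite -ball_normE/= distrC.
  rewrite -(subnKC Nn); apply: le_lt_trans (cau _ _ _ x0) _.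
  by rewrite mulrAC.
pose u x := limn (fun n => S n x).
have uS n x : 0 <= x -> `|u x - S n x| <= C * (1 / 2) ^+ n * expR (m * x).
  move=> x0; have h : `|S k x - S n x| @[k --> \oo] --> `|u x - S n x|.
    by apply: cvg_norm; apply: cvgB; [exact: Scvg|exact: cvg_cst].
  rewrite -(cvg_lim _ h)//; apply: limr_le; first by apply/cvg_ex; eexists; exact: h.
  exists n => // k /= nk; by rewrite -(subnKC nk) cau.
(* For arguments up to [pos x + 1] the weight is bounded, hence the iterates converge uniformly near
   [x]. *)
have cu : continuous (u \o pos).
  move=> x; apply/cvgrPdist_lt => e e0.
  pose M := C * expR (m * (pos x + 1)).
  have M0 : 0 <= M by rewrite mulr_ge0 ?expR_ge0.
  have e3 : 0 < e / 3 by lra.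
  have [N hN] := half0 M _ e3 M0.
  have eM y : pos y <= pos x + 1 -> `|u (pos y) - S N (pos y)| < e / 3.
    move=> yx; apply: le_lt_trans (uS N _ (pos_ge0 y)) _.
    apply: le_lt_trans hN; rewrite mulrAC ler_wpM2r ?exprn_ge0//.
    by rewrite ler_wpM2l// ler_expR ler_wpM2l// ltW.
  near=> y.
  have h1 : `|S N (pos x) - S N (pos y)| < e / 3.
    by near: y; move: (cS N x) => /cvgrPdist_lt/(_ _ e3).
  have h2 := eM x; have h3 : `|u (pos y) - S N (pos y)| < e / 3.
    apply: eM; have : `|pos x - pos y| < 1.
      by near: y; move: (@cpos x) => /cvgrPdist_lt/(_ _ ltr01).
    by rewrite ltr_norml => /andP[]; lra.
  have {}h2 : `|u (pos x) - S N (pos x)| < e / 3 by apply: h2; lra.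
  rewrite /=; move: h1 h2 h3; rewrite !ltr_norml => /andP[? ?] /andP[? ?] /andP[? ?].
  by apply/andP; split; lra.
(* The contraction estimate itself carries [K] to the limit: [u - S N.+1] and [K u - K (S N)] are
   both small, and no exchange of limit and integral is needed. *)
have fixu x : 0 <= x -> u x = y0 x + K u x.
  move=> x0; apply/eqP; rewrite -subr_eq0 -normr_le0; apply/ler_addgt0Pr => e e0.
  rewrite add0r; have e2 : 0 < e / 2 by lra.
  have [|N hN] := half0 (C * expR (m * x)) _ e2; first by rewrite mulr_ge0 ?expR_ge0.
  have h1 := uS N.+1 x x0.
  have h2 : `|K u x - K (S N) x| <= C * (1 / 2) ^+ N / 2 * expR (m * x).
    apply: KBB x0 => //; first by rewrite mulr_ge0// exprn_ge0.
    by move=> y; exact: uS.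
  have {}h1 : `|u x - S N.+1 x| <= e / 2.
    apply: le_trans h1 _; apply: le_trans (ltW hN).
    rewrite mulrAC exprS; have : 0 <= C * expR (m * x) * (1 / 2) ^+ N.
      by rewrite !mulr_ge0 ?expR_ge0 ?exprn_ge0.
    by move=> ?; lra.
  have {}h2 : `|K u x - K (S N) x| <= e / 2.
    apply: le_trans h2 _; apply: le_trans (ltW hN).
    have : 0 <= C * expR (m * x) * (1 / 2) ^+ N.
      by rewrite !mulr_ge0 ?expR_ge0 ?exprn_ge0.
    by move=> ?; rewrite -mulrA (mulrC _^-1) mulrA mulrAC; lra.
  have -> : u x - (y0 x + K u x) = (u x - S N.+1 x) - (K u x - K (S N) x).
    by rewrite /S /= -/(S N) /T; ring.
  apply: le_trans (ler_normB _ _) _; lra.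
have [k0 k'0 dk dk'] := KP _ cu.
exists (fun x => y0 x + K u x), (fun x => b + K' u x); split.
- by rewrite k0 /y0 mulr0 !addr0.
- by rewrite k'0 addr0.
- by move=> x x0; apply: is_derive_pD => //; exact: dk.
- move=> x x0; rewrite -fixu//.
  apply: (is_derive_eq (is_derive_pD (is_derive_pcst x b) (dk' _ x0))).
  by rewrite add0r.
Unshelve. all: by end_near. Qed.

End Picard.
End ODE.

(** * Energies and the resonant coefficient *)

Section Oscillator.
Context {R : realType}.
Implicit Types (c u : R -> R) (lam a b : R).

Definition oscillator c lam a b u (u' : R -> R) := forall x : R, a <= x <= b ->
  is_derive x 1 u (u' x) /\ is_derive x 1 u' (- (lam ^+ 2 * c x * u x)).

Definition energy lam u (u' : R -> R) (x : R) := u' x ^+ 2 + lam ^+ 2 * u x ^+ 2.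

Lemma energy_ge0 lam u u' x : 0 <= energy lam u u' x.
Proof. by rewrite addr_ge0 ?sqr_ge0// mulr_ge0 ?sqr_ge0. Qed.

Lemma oscillatorW c lam a b a' b' u u' : a <= a' -> b' <= b ->
  oscillator c lam a b u u' -> oscillator c lam a' b' u u'.
Proof.
move=> aa bb h x /andP[ax xb]; apply: h.
by rewrite (le_trans aa ax) (le_trans xb bb).
Qed.

Lemma is_derive_psqr (x : R) f a : is_derive x 1 f a ->
  is_derive x 1 (fun t => f t ^+ 2) (2 * f x * a).
Proof.
move=> h; rewrite (_ : (fun t => f t ^+ 2) = (fun t => f t * f t)); last first.
  by apply/funext => t; rewrite expr2.
by apply: (is_derive_eq (is_derive_pM h h)); ring.
Qed.

Lemma gronwall_sym (f df : R -> R) (K a b s t : R) : 0 <= K ->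
  (forall x : R, a <= x <= b -> is_derive x 1 f (df x)) ->
  (forall x : R, a <= x <= b -> `|df x| <= K * f x) ->
  (forall x : R, a <= x <= b -> 0 <= f x) ->
  a <= s <= b -> a <= t <= b -> f t <= f s * expR (K * (b - a)).
Proof.
move=> K0 h hK f0 /andP[as_ sb] /andP[at_ tb].
have fs0 : 0 <= f s by rewrite f0// as_.
have ex (d : R) : d <= b - a -> f s * expR (K * d) <= f s * expR (K * (b - a)).
  by move=> dba; rewrite ler_wpM2l// ler_expR ler_wpM2l.
have /orP[st|ts] := le_total s t.
  have [x /andP[sx xt]|x /andP[sx xt]|h1 _] := @gronwall _ f df K _ _ st.
  - by apply: h; rewrite (le_trans as_)//= (le_trans xt).
  - by apply: hK; rewrite (le_trans as_)//= (le_trans xt).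
  - by apply: le_trans h1 _; apply: ex; rewrite lerB.
have [x /andP[sx xt]|x /andP[sx xt]|_ h1] := @gronwall _ f df K _ _ ts.
- by apply: h; rewrite (le_trans at_)//= (le_trans xt).
- by apply: hK; rewrite (le_trans at_)//= (le_trans xt).
- by apply: le_trans h1 _; apply: ex; rewrite lerB.
Qed.

(** The derivative of the energy is 2 lam^2 (1 - c) u u', at most lam d times the energy. This
    depends on the frequency, so it serves where [d = 0], where lam (b - a) is bounded, and for
    uniqueness. *)
Lemma energy_flat c lam a b u u' (d s t : R) : 0 <= lam -> 0 <= d ->
  oscillator c lam a b u u' -> (forall x : R, a <= x <= b -> `|c x - 1| <= d) ->
  a <= s <= b -> a <= t <= b ->
  energy lam u u' t <= energy lam u u' s * expR (lam * d * (b - a)).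
Proof.
move=> l0 d0 osc cd; apply: (@gronwall_sym _
  (fun x => 2 * u' x * (- (lam ^+ 2 * c x * u x)) + lam ^+ 2 * (2 * u x * u' x))) => [|x ab|x ab|x ab].
- by rewrite mulr_ge0.
- have [du du'] := osc _ ab.
  exact: is_derive_pD (is_derive_psqr du') (is_derive_pZ (lam ^+ 2) (is_derive_psqr du)).
- rewrite (_ : _ + _ = - (lam * (c x - 1) * (2 * u' x * (lam * u x)))); last by ring.
  rewrite normrN normrM; apply: ler_pM => //.
    by rewrite normrM (ger0_norm l0) ler_wpM2l// cd.
  rewrite /energy -exprMn ler_norml; set p := u' x; set q := lam * u x.
  by have := sqr_ge0 (p + q); have := sqr_ge0 (p - q) => h1 h2; apply/andP; split; lra.
- exact: energy_ge0.
Qed.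

(* The energy [u'^2 + lam^2 c0 u^2] has derivative [lam^2 dc u^2]: the bound does
   not depend on the frequency. *)
Lemma energy_smooth c c0 dc lam a b u u' (M s t : R) : 0 <= M ->
  oscillator c lam a b u u' ->
  (forall x : R, a <= x <= b -> [/\ c x = c0 x, is_derive x 1 c0 (dc x),
     1 / 2 <= c0 x <= 3 / 2 & `|dc x| <= M]) ->
  a <= s <= b -> a <= t <= b ->
  energy lam u u' t <= 3 * expR (2 * M * (b - a)) * energy lam u u' s.
Proof.
move=> M0 osc hc sab tab.
pose e x := u' x ^+ 2 + lam ^+ 2 * (c0 x * u x ^+ 2).
(* Passing between the two energies costs 3/2 in one direction and 2 in the other, hence the factor
   3; the bound lam^2 u^2 <= 2 e gives the rate 2 M. *)
have le x : a <= x <= b -> e x <= 3 / 2 * energy lam u u' x /\ energy lam u u' x <= 2 * e x.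
  move=> /hc[_ _ /andP[c1 c2] _]; rewrite /e /energy.
  have := sqr_ge0 (u' x); have : 0 <= lam ^+ 2 * u x ^+ 2 by rewrite mulr_ge0// sqr_ge0.
  rewrite mulrCA; set p := u' x ^+ 2; set q := lam ^+ 2 * u x ^+ 2; nra.
have e_ge0 x : a <= x <= b -> 0 <= e x.
  by move=> /le[_]; have := energy_ge0 lam u u' x; lra.
have h : e t <= e s * expR (2 * M * (b - a)).
  apply: (@gronwall_sym _ (fun x => 2 * u' x * (- (lam ^+ 2 * c x * u x)) +
     lam ^+ 2 * (dc x * u x ^+ 2 + c0 x * (2 * u x * u' x)))) => // [|x ab|x ab].
  - by rewrite mulr_ge0.
  - have [du du'] := osc _ ab; have [_ dc0 _ _] := hc _ ab.
    exact: is_derive_pD (is_derive_psqr du')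
      (is_derive_pZ (lam ^+ 2) (is_derive_pM dc0 (is_derive_psqr du))).
  - have [-> _ /andP[c1 c2] cM] := hc _ ab.
    rewrite (_ : _ + _ = dc x * (lam ^+ 2 * u x ^+ 2)); last by ring.
    have q0 : 0 <= lam ^+ 2 * u x ^+ 2 by rewrite mulr_ge0// sqr_ge0.
    rewrite normrM (ger0_norm q0); apply: le_trans (ler_wpM2r q0 cM) _.
    apply: (@le_trans _ _ (M * (2 * e x))); last by rewrite mulrA (mulrC M).
    rewrite ler_wpM2l// /e (mulrCA _ (c0 x)).
    have : 0 <= u' x ^+ 2 by rewrite sqr_ge0.
    by move: (u' x ^+ 2) (lam ^+ 2 * u x ^+ 2) q0 => p q q0 p0; nra.
have [_ h1] := le _ tab; have [h2 _] := le _ sab.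
apply: le_trans h1 _; rewrite [leRHS]mulrAC.
apply: (@le_trans _ _ (2 * (e s * expR (2 * M * (b - a))))); first by rewrite ler_wpM2l.
by rewrite mulrA ler_wpM2r ?expR_ge0//; lra.
Qed.

Lemma oscillator_unique c lam a b u u' w w' : 0 < lam ->
  (forall x : R, a <= x <= b -> `|c x - 1| <= 1) ->
  oscillator c lam a b u u' -> oscillator c lam a b w w' ->
  u a = w a -> u' a = w' a -> forall x : R, a <= x <= b -> u x = w x /\ u' x = w' x.
Proof.
move=> l0 c1 ou ow e0 e1 x xab.
have aab : a <= a <= b by rewrite lexx; case/andP: xab; exact: le_trans.
have od : oscillator c lam a b (fun t => u t - w t) (fun t => u' t - w' t).
  move=> t tab; have [du du'] := ou _ tab; have [dw dw'] := ow _ tab.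
  split; first exact: is_derive_pB.
  by apply: (is_derive_eq (is_derive_pB du' dw')); ring.
have := energy_flat (ltW l0) ler01 od c1 aab xab.
have := energy_ge0 lam (fun t => u t - w t) (fun t => u' t - w' t) x.
rewrite {2 3}/energy e0 e1 !subrr !expr0n/= mulr0 addr0 mul0r.
move=> h1 h2; have {h1 h2} : energy lam (fun t => u t - w t) (fun t => u' t - w' t) x == 0.
  by rewrite eq_le h2 h1.
rewrite /energy -exprMn paddr_eq0 ?sqr_ge0// !sqrf_eq0 mulf_eq0 !subr_eq0 (gt_eqF l0)/=.
by move=> /andP[/eqP ? /eqP].
Qed.

(** [ode_exists] prescribes data at 0, whereas here they are prescribed at [T]. The Wronskian of the
    two basic solutions stays equal to 1, so the data at [T] can be matched by an explicit
    combination. *)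
Lemma oscillator_exists c lam (T al : R) : continuous c ->
  (forall x : R, 1 / 2 <= c x <= 3 / 2) -> 0 <= T ->
  exists u u', [/\ u T = 0, u' T = al & forall b, oscillator c lam 0 b u u'].
Proof.
move=> cc cb T0; pose q x := lam ^+ 2 * c x.
have cq : continuous q by move=> x; apply: cvgMr; exact: cc.
have qQ x : `|q x| <= lam ^+ 2 * (3 / 2).
  have := cb x => /andP[c1 c2]; rewrite normrM ger0_norm ?sqr_ge0// ler_wpM2l ?sqr_ge0//.
  by rewrite ger0_norm//; lra.
have [u1 [u1' [a1 b1 d1 d1']]] := ode_exists 1 0 cq qQ.
have [u2 [u2' [a2 b2 d2 d2']]] := ode_exists 0 1 cq qQ.
have W : u1 T * u2' T - u1' T * u2 T = 1.
  pose W x := u1 x * u2' x - u1' x * u2 x.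
  have dW x : 0 <= x <= T -> is_derive x 1 W 0.
    move=> /andP[x0 _]; apply: (is_derive_eq (is_derive_pB
      (is_derive_pM (d1 _ x0) (d2' _ x0)) (is_derive_pM (d1' _ x0) (d2 _ x0)))).
    ring.
  have [y _] := MVT_is_derive T0 dW; rewrite mul0r => /eqP; rewrite subr_eq0 => /eqP.
  by rewrite /W a1 b1 a2 b2 mulr1 mulr0 subr0.
exists (fun x => al * (- u2 T) * u1 x + al * u1 T * u2 x),
  (fun x => al * (- u2 T) * u1' x + al * u1 T * u2' x); split.
- ring.
- by rewrite -[RHS]mulr1 -W; ring.
- move=> b x /andP[x0 _]; split.
    exact: is_derive_pD (is_derive_pZ _ (d1 _ x0)) (is_derive_pZ _ (d2 _ x0)).
  apply: (is_derive_eq (is_derive_pD (is_derive_pZ _ (d1' _ x0)) (is_derive_pZ _ (d2' _ x0)))).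
  rewrite /q; ring.
Qed.

(** * The explicit resonant solution *)

Section Resonance.
Variables eps lam T : R.
Hypotheses (e0 : 0 <= eps) (e1 : eps <= 1 / 10) (l0 : 0 < lam).

Let eps_le1 : eps <= 1.
Proof. by apply: (le_trans e1); lra. Qed.

(* If [w = sin x * exp h] with [x = lam (t - T)] and [dh/dx = eps sin^2 x], then
   [w'' = - lam ^+ 2 * rcoef x * w]. *)
Definition rcoef (x : R) := 1 - 4 * eps * (sin x * cos x) - eps ^+ 2 * (sin x ^+ 2) ^+ 2.

Let ph (t : R) := lam * (t - T).

Let sc (x : R) : 0 <= sin x ^+ 2 <= 1 /\ - (1 / 2) <= sin x * cos x <= 1 / 2.
Proof.
have := cos2Dsin2 x; have := sqr_ge0 (sin x); have := sqr_ge0 (cos x).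
have := sqr_ge0 (sin x + cos x); have := sqr_ge0 (sin x - cos x).
move: (sin x) (cos x) => s k; nra.
Qed.

Lemma rcoef_dist x : `|rcoef x - 1| <= 5 * eps.
Proof.
have h0 := e0; have [/andP[s1 s2] /andP[s3 s4]] := sc x; rewrite /rcoef.
move: (sin x ^+ 2) (sin x * cos x) s1 s2 s3 s4 => s p s1 s2 s3 s4.
have s5 : 0 <= s ^+ 2 <= 1 by rewrite sqr_ge0 exprn_ile1.
move: (s ^+ 2) s5 => s' /andP[s5 s6].
have p1 : (- (2 * eps) <= 4 * eps * p) /\ (4 * eps * p <= 2 * eps).
  have q1 : 0 <= eps * (1 / 2 - p) by rewrite mulr_ge0//; lra.
  have q2 : 0 <= eps * (1 / 2 + p) by rewrite mulr_ge0//; lra.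
  by split; lra.
have p2 : 0 <= eps ^+ 2 * s' by rewrite mulr_ge0 ?sqr_ge0.
have p3 : eps ^+ 2 * s' <= eps.
  rewrite expr2 -mulrA ler_piMr//.
  apply: (@le_trans _ _ (1 * 1)); last by rewrite mulr1.
  by rewrite ler_pM.
by case: p1 => *; rewrite ler_norml; apply/andP; split; lra.
Qed.

(** This is the use of the threshold 1/10: the deviation from 1 is at most 5 eps <= 1/2. *)
Lemma rcoef_range x : 1 / 2 <= rcoef x <= 3 / 2.
Proof.
by have h := e1; have := rcoef_dist x; rewrite ler_norml => /andP[h1 h2]; apply/andP; split; lra.
Qed.

Definition drcoef (t : R) := lam * (- (4 * eps * (cos (ph t) ^+ 2 - sin (ph t) ^+ 2))
  - 4 * eps ^+ 2 * sin (ph t) ^+ 2 * (sin (ph t) * cos (ph t))).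

Let dph (t : R) : is_derive t 1 ph lam.
Proof.
apply: (is_derive_eq (is_derive_pZ lam (is_derive_pB (is_derive_pid t) (is_derive_pcst t T)))).
by rewrite subr0 mulr1.
Qed.

Lemma is_derive_rcoef (t : R) : is_derive t 1 (fun t => rcoef (ph t)) (drcoef t).
Proof.
have ds := is_derive_psin (dph t); have dk := is_derive_pcos (dph t).
apply: (is_derive_eq (is_derive_pB (is_derive_pB (is_derive_pcst t 1)
  (is_derive_pZ (4 * eps) (is_derive_pM ds dk)))
  (is_derive_pZ (eps ^+ 2) (is_derive_psqr (is_derive_psqr ds))))).
by rewrite /drcoef; ring.
Qed.

Lemma drcoef_le t : `|drcoef t| <= 8 * eps * lam.
Proof.
rewrite /drcoef normrM (gtr0_norm l0) [leRHS]mulrC ler_pM2l//.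
have h0 := e0; have [/andP[s1 s2] /andP[s3 s4]] := sc (ph t).
have := cos2Dsin2 (ph t).
move: (sin (ph t) ^+ 2) (cos (ph t) ^+ 2) (sin (ph t) * cos (ph t)) s1 s2 s3 s4 => s k p s1 s2 s3 s4 ks.
have q1 : 0 <= eps * k by rewrite mulr_ge0//; lra.
have q2 : 0 <= eps * s by rewrite mulr_ge0.
have qs : eps * k + eps * s = eps by rewrite -mulrDr ks mulr1.
have p2 : `|s * p| <= 1.
  rewrite normrM (ger0_norm s1); apply: (@le_trans _ _ (1 * 1)); last by rewrite mulr1.
  by rewrite ler_pM// ler_norml; apply/andP; split; lra.
have p3 : `|eps ^+ 2 * (s * p)| <= eps.
  rewrite normrM (ger0_norm (sqr_ge0 _)) expr2 -mulrA ler_piMr//.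
  apply: (@le_trans _ _ (1 * 1)); last by rewrite mulr1.
  by rewrite ler_pM.
move: p3; rewrite -!mulrA !ler_norml => /andP[p3 p4].
by apply/andP; split; lra.
Qed.

(** The primitive of eps sin^2 that vanishes at 0. *)
Definition rexpo (x : R) := eps * (x - sin x * cos x) / 2.

Definition rsol al (t : R) := al / lam * (sin (ph t) * expR (rexpo (ph t))).

Definition rsol' al (t : R) := al * ((cos (ph t) + eps * (sin (ph t) ^+ 2 * sin (ph t)))
  * expR (rexpo (ph t))).

Let dexpo (t : R) : is_derive t 1 (fun t => expR (rexpo (ph t)))
  (lam * eps * sin (ph t) ^+ 2 * expR (rexpo (ph t))).
Proof.
have ds := is_derive_psin (dph t); have dk := is_derive_pcos (dph t).
have d1 := is_derive_pZ (eps / 2) (is_derive_pB (dph t) (is_derive_pM ds dk)).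
have -> : (fun t => expR (rexpo (ph t))) =
    (fun t => expR (eps / 2 * (ph t - sin (ph t) * cos (ph t)))).
  by apply/funext => x; rewrite /rexpo; congr expR; ring.
apply: (is_derive_eq (is_derive_pexp d1)).
rewrite (_ : rexpo (ph t) = eps / 2 * (ph t - sin (ph t) * cos (ph t))); last first.
  by rewrite /rexpo; ring.
congr (_ * _).
have ck : cos (ph t) ^+ 2 = 1 - sin (ph t) ^+ 2 by rewrite -(cos2Dsin2 (ph t)) addrK.
rewrite (_ : eps / 2 * _ = eps / 2 * lam * (1 - cos (ph t) ^+ 2 + sin (ph t) ^+ 2)); last by ring.
by rewrite ck; field.
Qed.

Lemma rsol_oscillator al a b :
  oscillator (fun t => rcoef (ph t)) lam a b (rsol al) (rsol' al).
Proof.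
move=> t _; have ds := is_derive_psin (dph t); have dk := is_derive_pcos (dph t).
split.
  apply: (is_derive_eq (is_derive_pZ (al / lam) (is_derive_pM ds (dexpo t)))).
  by rewrite /rsol'; field; rewrite gt_eqF.
apply: (is_derive_eq (is_derive_pZ al (is_derive_pM (is_derive_pD dk
  (is_derive_pZ eps (is_derive_pM (is_derive_psqr ds) ds))) (dexpo t)))).
by rewrite /rsol /rcoef; field; rewrite gt_eqF.
Qed.

Lemma rexpo_le (x y : R) : x <= y -> rexpo x <= rexpo y.
Proof.
move=> xy; apply: (@is_derive_nondecreasing _ rexpo (fun x => eps * sin x ^+ 2)) => // t _; last first.
  by rewrite mulr_ge0 ?sqr_ge0.
have ds := is_derive_psin (is_derive_pid t); have dk := is_derive_pcos (is_derive_pid t).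
have -> : rexpo = (fun t => eps / 2 * (t - sin t * cos t)).
  by apply/funext => z; rewrite /rexpo; ring.
apply: (is_derive_eq (is_derive_pZ (eps / 2) (is_derive_pB (is_derive_pid t) (is_derive_pM ds dk)))).
have ck : cos t ^+ 2 = 1 - sin t ^+ 2 by rewrite -(cos2Dsin2 t) addrK.
rewrite (_ : eps / 2 * _ = eps / 2 * (1 - cos t ^+ 2 + sin t ^+ 2)); last by ring.
by rewrite ck; field.
Qed.

Lemma rsol_energy al t : energy lam (rsol al) (rsol' al) t <=
  5 * (al ^+ 2 * expR (rexpo (ph t)) ^+ 2).
Proof.
rewrite /energy /rsol /rsol'; set X := expR _; set s := sin _; set k := cos _.
have -> : (al * ((k + eps * (s ^+ 2 * s)) * X)) ^+ 2 + lam ^+ 2 * (al / lam * (s * X)) ^+ 2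
  = (al ^+ 2 * X ^+ 2) * ((k + eps * (s ^+ 2 * s)) ^+ 2 + s ^+ 2).
  by field; rewrite gt_eqF.
have al0 : 0 <= al ^+ 2 * X ^+ 2 := mulr_ge0 (sqr_ge0 _) (sqr_ge0 _).
rewrite mulrC; apply: (ler_wpM2r al0).
have [/andP[s1 s2] _] := sc (ph t); have := cos2Dsin2 (ph t); rewrite -/s -/k in s1 s2 * => ks.
have h : (k + eps * (s ^+ 2 * s)) ^+ 2 <= 2 * k ^+ 2 + 2 * (eps ^+ 2 * (s ^+ 2) ^+ 3).
  by have := sqr_ge0 (k - eps * (s ^+ 2 * s)); lra.
have h2 : (s ^+ 2) ^+ 3 <= 1 by apply: exprn_ile1.
have h3 : 0 <= (s ^+ 2) ^+ 3 by rewrite exprn_ge0.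
have h4 : eps ^+ 2 * (s ^+ 2) ^+ 3 <= 1 by rewrite mulr_ile1 ?sqr_ge0// exprn_ile1.
move: ((k + _) ^+ 2) h => Y h.
move: (eps ^+ 2 * _) h h4 => Z h h4.
by have := sqr_ge0 k; lra.
Qed.

Section Endpoint.
Variable S : R.
Hypothesis sinS : sin (ph S) = 0.

(** At a zero of the sine the oscillating part of [rexpo] disappears, so the gain in energy is an
    exact exponential. *)
Lemma rsol_end al : energy lam (rsol al) (rsol' al) S = al ^+ 2 * expR (eps * (lam * (S - T))).
Proof.
have kS : cos (ph S) ^+ 2 = 1.
  by have := cos2Dsin2 (ph S); rewrite sinS expr0n/= addr0.
rewrite /energy /rsol /rsol' sinS /rexpo sinS expr0n/=.
rewrite !(mul0r, mulr0) addr0 expr0n/= mulr0 addr0 subr0 !exprMn kS mul1r.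
by rewrite -expRM_natl; congr (_ * expR _); rewrite /ph; field.
Qed.

End Endpoint.

Lemma rsol_start al : rsol al T = 0 /\ rsol' al T = al.
Proof.
rewrite /rsol /rsol' /rexpo /ph subrr mulr0 sin0 cos0 !(mul0r, mulr0) subr0.
by rewrite mulr0 mul0r expR0 addr0 !mulr1.
Qed.

End Resonance.
End Oscillator.

(** * Choice of the frequencies and of the coefficient *)

Section Modulus.
Context {R : realType}.
Variable omega : R -> R.
Hypotheses (omega_cont : {within `[0, +oo[, continuous omega})
  (omega0 : omega 0 = 0) (omega_ge0 : forall a, 0 <= a -> 0 <= omega a).

Lemma modulus_small (e : R) : 0 < e ->
  exists2 d : R, 0 < d & forall r : R, 0 <= r -> r < d -> omega r < e.
Proof.
move=> e0; have [_ c0] := (continuous_within_itvcyP 0 omega).1 omega_cont.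
move/cvgrPdist_lt : c0 => /(_ e e0); rewrite omega0.
move=> [d /= d0 hd]; exists d => // r r0 rd.
have [->|rn0] := eqVneq r 0; first by rewrite omega0.
have rp : 0 < r by rewrite lt_neqAle eq_sym rn0.
have := hd r; rewrite /= sub0r normrN ger0_norm// => /(_ rd rp).
by rewrite sub0r normrN ger0_norm// omega_ge0.
Qed.

End Modulus.

Section Construction.
Context {R : realType}.
Variables (lam : nat -> R) (omega phi : R -> R).
Hypotheses (lam_gt0 : forall k, 0 < lam k)
  (lam_increasing : forall i j, (i < j)%N -> lam i < lam j)
  (lam_unbounded : forall M : R, exists k, M < lam k)
  (omega_ge0 : forall a, 0 <= a -> 0 <= omega a)
  (omega_cont : {within `[0, +oo[, continuous omega})
  (omega0 : omega 0 = 0)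
  (phi_ge1 : forall s, 0 <= s -> 1 <= phi s)
  (phi_omega : (s / phi s * omega (1 / s)) @[s --> +oo] --> +oo).

Lemma lam_eventually (P : R -> Prop) (n0 : nat) :
  (\forall s \near +oo, P s) -> exists2 n, (n0 <= n)%N & P (lam n).
Proof.
move=> [M [_ hM]]; have [k Mk] := lam_unbounded M.
exists (maxn n0 k); first exact: leq_maxl.
apply: hM; apply: (lt_le_trans Mk).
have : (k <= maxn n0 k)%N by exact: leq_maxr.
by rewrite leq_eqVlt => /predU1P[<-//|/lam_increasing/ltW].
Qed.

(** Every requirement holds for all large frequencies, so they can be met together beyond any index.
    The one on [phi] is the limit hypothesis with threshold 4 k / s. *)
Lemma step_exists (k n0 : nat) (s M : R) : 0 < s ->
  exists nN : nat * nat, [/\ (n0 <= nN.1)%N, 1 <= lam nN.1 /\ omega (1 / lam nN.1) <= 1 / 10,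
    s / 4 <= pi * nN.2%:R / lam nN.1 <= s / 2,
    k%:R * phi (lam nN.1) <= omega (1 / lam nN.1) * lam nN.1 * (s / 4) & M <= lam nN.1].
Proof.
move=> s0.
have e10 : 0 < 1 / 10 :> R by lra.
have [d d0 hd] := modulus_small omega_cont omega0 omega_ge0 e10.
suff [n n0n [l1 lo lp lf lM]] : exists2 n, (n0 <= n)%N &
    [/\ 1 <= lam n, omega (1 / lam n) <= 1 / 10, 4 * pi <= lam n * s,
        k%:R * phi (lam n) <= omega (1 / lam n) * lam n * (s / 4) & M <= lam n].
  have l0 := lam_gt0 n; move: (pi : R) (pi_gt0 R) lp => p p0 lp.
  (* The number of half-periods is the integer part of [x]: being at most [x] it yields the bound s
     / 2, and as x >= 2 it is at least x / 2, which yields s / 4. *)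
  pose x := lam n * s / (2 * p).
  have x2 : 2 <= x by rewrite /x ler_pdivlMr ?mulr_gt0//; lra.
  have x0 : 0 <= x by lra.
  have /andP[Nx xN] := truncn_itv x0.
  exists (n, Num.truncn x); split => //=.
  have [N [{}Nx {}xN ->]] : exists N : R, [/\ N <= x, x < N + 1 & (Num.truncn x)%:R = N].
    by exists (Num.truncn x)%:R; rewrite -[X in _ + X]/(1%:R) -natrD addn1.
  have e : s = x * (2 * p) / lam n by rewrite /x; field; rewrite !gt_eqF.
  rewrite e; apply/andP; split.
    rewrite (_ : _ / 4 = p * (x / 2) / lam n); last by field; rewrite gt_eqF.
    rewrite ler_pM2r ?invr_gt0// ler_pM2l//.
    lra.
  rewrite (_ : _ / 2 = p * x / lam n); last by field; rewrite gt_eqF.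
  by rewrite ler_pM2r ?invr_gt0// ler_pM2l.
apply: (@lam_eventually (fun x => [/\ 1 <= x, omega (1 / x) <= 1 / 10, 4 * pi <= x * s,
  k%:R * phi x <= omega (1 / x) * x * (s / 4) & M <= x])); near=> x.
have x0 : 0 < x by near: x; apply: nbhs_pinfty_gt; exact: num_real.
split.
- near: x; apply: nbhs_pinfty_ge; exact: num_real.
- apply/ltW/hd; first by rewrite divr_ge0// ltW.
  by rewrite mul1r invf_plt ?posrE//; near: x; apply: nbhs_pinfty_gt; exact: num_real.
- rewrite -ler_pdivrMr//; near: x; apply: nbhs_pinfty_ge; exact: num_real.
- have : 4 * k%:R / s <= x / phi x * omega (1 / x).
    by near: x; move/cvgryPge : phi_omega; exact.
  have f0 : 0 < phi x by apply: lt_le_trans (phi_ge1 (ltW x0)).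
  rewrite ler_pdivrMr// => h.
  have -> : omega (1 / x) * x * (s / 4) = (x / phi x * omega (1 / x) * s) * phi x / 4.
    by field; rewrite gt_eqF.
  by rewrite ler_pdivlMr// mulrAC ler_wpM2r ?(ltW f0)// mulrC.
- near: x; apply: nbhs_pinfty_ge; exact: num_real.
Unshelve. all: by end_near. Qed.

End Construction.

Section Schedule.
Context {R : realType}.
Variables (lam : nat -> R) (omega phi : R -> R).

Record schedule (n N : nat -> nat) (s t M : nat -> R) : Prop := Schedule {
  sch_s0 : s 0%N = 1;
  sch_M0 : M 0%N = 1;
  sch_n : forall k, (n k < n k.+1)%N;
  sch_lam : forall k, 1 <= lam (n k);
  sch_omega : forall k, omega (1 / lam (n k)) <= 1 / 10;
  sch_t : forall k, t k = s k - pi * (N k)%:R / lam (n k);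
  sch_len : forall k, s k / 4 <= s k - t k <= s k / 2;
  sch_s : forall k, s k.+1 = Num.min (t k) (1 / lam (n k));
  (* the factor bounds the variation of the energy of a mode of any frequency on
     the interval from s_(k+1) to s_k *)
  sch_M : forall k, M k.+1 =
    M k * (3 * expR (2 * (8 * omega (1 / lam (n k)) * lam (n k)) * (s k - t k)));
  sch_phi : forall k, k%:R * phi (lam (n k)) <=
    omega (1 / lam (n k)) * (lam (n k) * (s k - t k));
  sch_big : forall k, (2 ^+ k * M k ^+ 2) ^+ k <= lam (n k) }.

Lemma schedule_exists :
  (forall k, 0 < lam k) -> (forall i j, (i < j)%N -> lam i < lam j) ->
  (forall M : R, exists k, M < lam k) ->
  (forall a, 0 <= a -> 0 <= omega a) -> {within `[0, +oo[, continuous omega} ->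
  omega 0 = 0 -> (forall s, 0 <= s -> 1 <= phi s) ->
  (s / phi s * omega (1 / s)) @[s --> +oo] --> +oo ->
  exists n N s t M, schedule n N s t M.
Proof.
move=> l0 li lu o0 oc oz p1 po.
(* The state [x] of the recursion holds s_k, M_k and a lower bound for the next index; the choice
   [y] is the pair (n_k, N_k). The guard [0 < x.1.1] lets a choice be made for every state. *)
pose P (k : nat) (x : R * R * nat) (y : nat * nat) := 0 < x.1.1 ->
  [/\ (x.2 <= y.1)%N, 1 <= lam y.1 /\ omega (1 / lam y.1) <= 1 / 10,
    x.1.1 / 4 <= pi * y.2%:R / lam y.1 <= x.1.1 / 2,
    k%:R * phi (lam y.1) <= omega (1 / lam y.1) * lam y.1 * (x.1.1 / 4) &
    (2 ^+ k * x.1.2 ^+ 2) ^+ k <= lam y.1].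
have ex k x : exists y, P k x y.
  have [x0|x0] := ltP 0 x.1.1; last by exists (0%N, 0%N) => /(le_lt_trans x0); rewrite ltxx.
  have [y hy] := step_exists l0 li lu o0 oc oz p1 po k x.2 ((2 ^+ k * x.1.2 ^+ 2) ^+ k) x0.
  by exists y.
pose f k x := projT1 (cid (ex k x)).
have fP k x : P k x (f k x) := projT2 (cid (ex k x)).
pose tt (x : R * R * nat) (y : nat * nat) := x.1.1 - pi * y.2%:R / lam y.1.
pose next k (x : R * R * nat) : R * R * nat :=
  let y := f k x in
  (Num.min (tt x y) (1 / lam y.1),
   x.1.2 * (3 * expR (2 * (8 * omega (1 / lam y.1) * lam y.1) * (x.1.1 - tt x y))), y.1.+1).
pose st := fix st k : R * R * nat := if k is k'.+1 then next k' (st k') else (1, 1, 0%N).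
have sp k : 0 < (st k).1.1.
  elim: k => [|k IH] /=; first exact: ltr01.
  have [_ [h1 _] /andP[_ h2] _ _] := fP k _ IH.
  rewrite lt_min divr_gt0// andbT /tt subr_gt0; apply: (le_lt_trans h2).
  by rewrite ltr_pdivrMr// ltr_pMr// ltr1n.
pose y k := f k (st k).
exists (fun k => (y k).1), (fun k => (y k).2), (fun k => (st k).1.1),
  (fun k => tt (st k) (y k)), (fun k => (st k).1.2).
have yP k := fP k _ (sp k).
have tE k : (st k).1.1 - tt (st k) (y k) = pi * (y k).2%:R / lam (y k).1.
  by rewrite /tt opprB addrC subrK.
split => // k.
- by have [] := yP k.+1.
- by have [_ []] := yP k.
- by have [_ []] := yP k.
- by rewrite tE; have [_ _] := yP k.
- have [_ [_ _] /andP[h1 _] h2 _] := yP k; rewrite tE; apply: (le_trans h2).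
  rewrite -mulrA; apply: ler_wpM2l; first by rewrite o0// divr_ge0// ltW.
  by rewrite ler_wpM2l// ltW.
- by have [] := yP k.
Qed.

End Schedule.

(** * The coefficient and its modulus of continuity *)

Section Coefficient.
Context {R : realType}.
Variables (lam : nat -> R) (omega phi : R -> R).
Variables (n N : nat -> nat) (s t M : nat -> R).
Hypothesis sch : schedule lam omega phi n N s t M.
Hypotheses (omega_ge0 : forall a, 0 <= a -> 0 <= omega a)
  (omega_cont : {within `[0, +oo[, continuous omega})
  (omega_increasing : forall a b, 0 <= a -> a < b -> omega a < omega b)
  (omega0 : omega 0 = 0)
  (omega_quotient : forall a b, 0 < a -> a <= b -> a / omega a <= b / omega b).

Let L k := lam (n k).
Let eps k := omega (1 / L k).

Let L1 k : 1 <= L k. Proof. exact: (sch_lam sch). Qed.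
Let L0 k : 0 < L k. Proof. exact: lt_le_trans ltr01 (L1 k). Qed.

Let eps_ge0 k : 0 <= eps k.
Proof. by rewrite omega_ge0// divr_ge0// ltW. Qed.

Let eps_le k : eps k <= 1 / 10. Proof. exact: (sch_omega sch). Qed.

Lemma sch_pos k : 0 < s k /\ 0 < t k.
Proof.
have tp j : 0 < s j -> 0 < t j.
  by move=> sj; have /andP[_] := sch_len sch j; lra.
suff sk : 0 < s k by split => //; exact: tp.
elim: k => [|k IH]; first by rewrite (sch_s0 sch).
by rewrite (sch_s sch) lt_min tp//= mul1r invr_gt0; exact: L0.
Qed.

Lemma sch_lt k : t k < s k.
Proof. by have [sk _] := sch_pos k; have /andP[+ _] := sch_len sch k; lra. Qed.

Lemma sch_st k : s k.+1 <= t k.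
Proof. by rewrite (sch_s sch) ge_min lexx. Qed.

Lemma sch_slam k : s k.+1 <= 1 / L k.
Proof. by rewrite (sch_s sch) ge_min lexx orbT. Qed.

Lemma sch_s_le i j : (i <= j)%N -> s j <= s i.
Proof.
move=> /subnKC <-; elim: (j - i)%N => [|d IH]; first by rewrite addn0.
by rewrite addnS; apply: le_trans IH; apply: le_trans (sch_st _) (ltW (sch_lt _)).
Qed.

Lemma sch_s_le1 k : s k <= 1.
Proof. by rewrite -(sch_s0 sch) sch_s_le. Qed.

Lemma sch_st_lt i j : (i < j)%N -> s j <= t i.
Proof. by move=> ij; apply: le_trans (sch_st i); exact: sch_s_le. Qed.

(** Each interval takes at least a quarter of [s k], so s_(k+1) <= t_k <= (3/4) s_k. *)
Lemma sch_s_small (x : R) : 0 < x -> exists k, s k <= x.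
Proof.
move=> x0; have h : ((3 / 4) ^+ k : R) @[k --> \oo] --> (0 : R).
  by apply: cvg_expr; rewrite ger0_norm//; lra.
have [K _ hK] := (cvgrPdist_lt _ _).1 h x x0.
exists K; apply: ltW; apply: le_lt_trans (_ : (3 / 4) ^+ K < x); last first.
  by have := hK K (leqnn K); rewrite sub0r normrN ger0_norm// exprn_ge0.
elim: K {hK} => [|k IH]; first by rewrite (sch_s0 sch).
apply: le_trans (sch_st k) _; rewrite exprS.
have /andP[+ _] := sch_len sch k; lra.
Qed.

Lemma sch_disjoint j k (x : R) : t k <= x <= s k -> t j < x < s j -> j = k.
Proof.
move=> /andP[tx xs] /andP[tj xj]; case: (ltngtP j k) => // jk; exfalso.
- by have := sch_st_lt jk; lra.
- by have := sch_st_lt jk; lra.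
Qed.

Definition ph k (x : R) := L k * (x - t k).

(** By [sch_disjoint] at most one [k] qualifies, so the choice is immaterial. The value is 1 off the
    unit interval: a coefficient on the whole line is what [oscillator_exists] takes. *)
Definition wcoef (x : R) : R :=
  if pselect (exists k, t k < x < s k) is left h then
    rcoef (eps (projT1 (cid h))) (ph (projT1 (cid h)) x) else 1.

Lemma sin_natpi (m : nat) : sin (pi * m%:R) = 0 :> R.
Proof.
elim: m => [|m IH]; first by rewrite mulr0 sin0.
by rewrite -addn1 natrD mulrDr mulr1 sinDpi IH oppr0.
Qed.

(** The interval holds a whole number [N k] of half-periods. Therefore the coefficient returns to 1
    at [s k], and [rsol_end] applies there. *)
Lemma sin_ph_end k : sin (ph k (s k)) = 0.
Proof.
rewrite /ph (_ : L k * (s k - t k) = pi * (N k)%:R) ?sin_natpi//.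
by rewrite (sch_t sch) subKr -/(L k) mulrC divfK// gt_eqF.
Qed.

Lemma wcoef_out x : (forall k, ~ t k < x < s k) -> wcoef x = 1.
Proof. by rewrite /wcoef => h; case: pselect => // h'; case: (cid h') => k /= /h. Qed.

Lemma wcoef_in k x : t k <= x <= s k -> wcoef x = rcoef (eps k) (ph k x).
Proof.
move=> txs; rewrite /wcoef; case: pselect => [h|nh].
  by case: (cid h) => j /= hj; rewrite (sch_disjoint txs hj).
have [txs'|nb] := boolP (t k < x < s k); first by exfalso; apply: nh; exists k.
have [tx|tx] := eqVneq (t k) x.
  by rewrite /ph -tx subrr mulr0 /rcoef sin0 !mul0r expr0n/=; ring.
have [xs|xs] := eqVneq (s k) x.
  by rewrite -xs /rcoef sin_ph_end !mul0r expr0n/=; ring.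
by move: nb; case/andP: txs => h1 h2; rewrite !lt_neqAle tx h1 h2 eq_sym xs.
Qed.

Lemma wcoef_gap k x : s k.+1 <= x <= t k -> wcoef x = 1.
Proof.
move=> /andP[h1 h2]; apply: wcoef_out => j /andP[tj sj].
have tsk := sch_lt k.
case: (ltngtP j k) => jk.
- by have := sch_st_lt jk; lra.
- by have := sch_s_le jk; lra.
- by move: tj; rewrite jk; lra.
Qed.

Lemma wcoef_range x : 1 / 2 <= wcoef x <= 3 / 2.
Proof.
have [[k /andP[h1 h2]]|h] := pselect (exists k, t k < x < s k).
  by rewrite (@wcoef_in k) ?rcoef_range// !ltW.
rewrite wcoef_out; first by apply/andP; split; lra.
by move=> k hk; apply: h; exists k.
Qed.

(** Up to distance 1 / L_k the Lipschitz constant 8 eps_k L_k is used, and monotonicity of sigma /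
    omega(sigma) gives eps_k L_k |a - b| <= omega |a - b|. Beyond that distance each value is within
    5 eps_k of 1, and eps_k <= omega |a - b|. *)
Lemma wcoef_lip k a b : t k <= a <= s k -> t k <= b <= s k ->
  `|wcoef a - wcoef b| <= 10 * omega `|a - b|.
Proof.
move=> ha hb; rewrite !(@wcoef_in k)//.
have [->|ab] := eqVneq a b; first by rewrite subrr normr0 mulr_ge0// omega_ge0.
have d0 : 0 < `|a - b| by rewrite normr_gt0 subr_eq0.
have o0 : 0 < omega `|a - b| by rewrite -omega0; exact: omega_increasing.
have [dL|dL] := leP `|a - b| (1 / L k).
  apply: (@le_trans _ _ (8 * eps k * L k * `|a - b|)).
    apply: (@is_derive_lipschitz _ (fun x => rcoef (eps k) (ph k x))
      (drcoef (eps k) (L k) (t k))) => x _; first exact: is_derive_rcoef.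
    exact: drcoef_le.
  have e0 : 0 < eps k by rewrite /eps -omega0; apply: omega_increasing => //; rewrite divr_gt0.
  have := omega_quotient d0 dL; rewrite ler_pdivrMr// -/(eps k) => h.
  have : L k * eps k * `|a - b| <= omega `|a - b|.
    apply: le_trans (ler_wpM2l (mulr_ge0 (ltW (L0 k)) (ltW e0)) h) _.
    by rewrite le_eqVlt; apply/orP; left; apply/eqP; field; rewrite !gt_eqF.
  rewrite (_ : 8 * eps k * L k * `|a - b| = 8 * (L k * eps k * `|a - b|)); last by ring.
  by move: o0 => /ltW o0 h1; lra.
rewrite -(subrKA 1); apply: le_trans (ler_normD _ _) _.
have := rcoef_dist (eps_ge0 k) (eps_le k) (ph k a); have := rcoef_dist (eps_ge0 k) (eps_le k) (ph k b).
rewrite (distrC 1).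
have : eps k <= omega `|a - b|.
  by apply/ltW/omega_increasing => //; rewrite divr_ge0// ltW.
lra.
Qed.

Let omega_le a b : 0 <= a -> a <= b -> omega a <= omega b.
Proof.
move=> a0; rewrite le_eqVlt => /predU1P[->//|ab]; exact/ltW/omega_increasing.
Qed.

(** Between [a] and [b] lies an endpoint of the interval, where the coefficient is 1; it is no
    farther from [a] than [b] is. *)
Lemma wcoef_lip1 k a b : t k < a < s k -> ~ t k < b < s k ->
  `|wcoef a - 1| <= 10 * omega `|a - b|.
Proof.
move=> /andP[ta sa] nb; have ts := sch_lt k.
have wt : wcoef (t k) = 1.
  rewrite (@wcoef_in k) ?lexx ?ltW// /ph subrr mulr0 /rcoef sin0 !mul0r expr0n/=; ring.
have ws : wcoef (s k) = 1.
  by rewrite (@wcoef_in k) ?lexx ?ltW// /rcoef sin_ph_end !mul0r expr0n/=; ring.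
have ha : t k <= a <= s k by rewrite !ltW.
have [bt|bt] := leP b (t k).
  rewrite -{1}wt; apply: le_trans (wcoef_lip ha _) _; first by rewrite lexx ltW.
  rewrite ler_wpM2l// omega_le// !ger0_norm; lra.
have [bs|bs] := leP (s k) b.
  rewrite -{1}ws; apply: le_trans (wcoef_lip ha _) _; first by rewrite lexx ltW.
  rewrite ler_wpM2l// omega_le// !ler0_norm; lra.
by exfalso; apply: nb; rewrite bt bs.
Qed.

(** Points not in a common interval are compared through the value 1, each at a cost of 10 omega.
    Thus the constant does not deteriorate as intervals accumulate. *)
Lemma wcoef_omega a b : `|wcoef a - wcoef b| <= 20 * omega `|a - b|.
Proof.
have o0 : 0 <= omega `|a - b| by exact: omega_ge0.
have out x y : (forall k, ~ (t k < x < s k /\ t k < y < s k)) ->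
    `|wcoef x - 1| <= 10 * omega `|x - y|.
  move=> h; have oxy : 0 <= omega `|x - y| by exact: omega_ge0.
  have [[k hk]|nk] := pselect (exists k, t k < x < s k).
    by apply: wcoef_lip1 (hk) _ => hy; apply: (h k).
  rewrite wcoef_out ?subrr ?normr0 ?mulr_ge0// => k hk; apply: nk; by exists k.
have [[k [/andP[a1 a2] /andP[b1 b2]]]|h] := pselect (exists k, t k < a < s k /\ t k < b < s k).
  by apply: (@le_trans _ _ (10 * omega `|a - b|)); [apply: (@wcoef_lip k); rewrite !ltW|lra].
rewrite -(subrKA 1); apply: le_trans (ler_normD _ _) _; rewrite (distrC 1).
have := out a b; have := out b a; rewrite (distrC b a).
move=> h1 h2; have {}h1 := h1 _; have {}h2 := h2 _.
have {}h1 : `|wcoef b - 1| <= 10 * omega `|a - b| by apply: h1 => k [? ?]; apply: h; exists k.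
have {}h2 : `|wcoef a - 1| <= 10 * omega `|a - b| by apply: h2 => k [? ?]; apply: h; exists k.
lra.
Qed.

Lemma wcoef_continuous : continuous wcoef.
Proof.
move=> x; apply/cvgrPdist_lt => e e0.
have e20 : 0 < e / 20 by lra.
have [d d0 hd] := modulus_small omega_cont omega0 omega_ge0 e20.
near=> y; apply: le_lt_trans (wcoef_omega x y) _.
have : omega `|x - y| < e / 20; last by lra.
apply: hd => //; near: y; exact: nbhsx_ballx.
Unshelve. all: by end_near. Qed.

End Coefficient.

(** * Growth of the modes *)

Section Energies.
Context {R : realType}.
Variables (lam : nat -> R) (omega phi : R -> R).
Variables (n N : nat -> nat) (s t M : nat -> R).
Hypothesis sch : schedule lam omega phi n N s t M.
Hypotheses (omega_ge0 : forall a, 0 <= a -> 0 <= omega a).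

Local Notation L k := (lam (n k)).
Local Notation eps k := (omega (1 / lam (n k))).
Local Notation c := (wcoef lam omega n s t).

Let L1 k : 1 <= L k. Proof. exact: (sch_lam sch). Qed.
Let L0 k : 0 < L k. Proof. exact: lt_le_trans ltr01 (L1 k). Qed.
Let eps_ge0 k : 0 <= eps k.
Proof. by rewrite omega_ge0// divr_ge0// ltW. Qed.
Let eps_le k : eps k <= 1 / 10. Proof. exact: (sch_omega sch). Qed.
Let crange x := wcoef_range sch omega_ge0 x.
Let st k := ltW (sch_lt sch k).

Lemma sch_M_ge1 k : 1 <= M k.
Proof.
elim: k => [|k IH]; first by rewrite (sch_M0 sch).
rewrite (sch_M sch) -[leLHS]mulr1; apply: ler_pM => //.
have : 1 <= expR (2 * (8 * eps k * L k) * (s k - t k)).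
  rewrite -[leLHS]expR0 ler_expR mulr_ge0// ?subr_ge0//.
  by rewrite !mulr_ge0// ltW.
lra.
Qed.

Section Solution.
Variables (l : R) (u u' : R -> R).
Hypotheses (l0 : 0 <= l) (osc : oscillator c l 0 1 u u').
Local Notation F := (energy l u u').

Lemma energy_gap k x y : s k.+1 <= x <= t k -> s k.+1 <= y <= t k -> F x <= F y.
Proof.
move=> hx hy; have [sp _] := sch_pos sch k.+1.
have o : oscillator c l (s k.+1) (t k) u u'.
  apply: oscillatorW osc; first exact: ltW.
  exact: le_trans (st k) (sch_s_le1 sch k).
have := energy_flat l0 (lexx 0) o _ hy hx.
rewrite mulr0 mul0r expR0 mulr1; apply=> z hz.
by rewrite (wcoef_gap sch hz) subrr normr0.
Qed.

Lemma energy_interval k x y : t k <= x <= s k -> t k <= y <= s k ->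
  F x <= 3 * expR (2 * (8 * eps k * L k) * (s k - t k)) * F y.
Proof.
move=> hx hy; have [_ tp] := sch_pos sch k.
have o : oscillator c l (t k) (s k) u u'.
  by apply: oscillatorW osc; [exact: ltW|exact: sch_s_le1 sch k].
apply: (energy_smooth (c0 := fun x => rcoef (eps k) (L k * (x - t k)))
  (dc := drcoef (eps k) (L k) (t k))) o _ hy hx.
  by rewrite !mulr_ge0// ltW.
move=> z hz; split.
- exact: (wcoef_in sch hz).
- exact: is_derive_rcoef.
- exact: rcoef_range.
- exact: drcoef_le.
Qed.

Lemma energy_step k x y : s k.+1 <= x <= s k -> s k.+1 <= y <= s k ->
  F x <= 3 * expR (2 * (8 * eps k * L k) * (s k - t k)) * F y.
Proof.
move=> /andP[x1 x2] /andP[y1 y2]; have stk := st k; have stk' := sch_st sch k.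
set C := 3 * _.
have C1 : 1 <= C.
  have : 1 <= expR (2 * (8 * eps k * L k) * (s k - t k)).
    rewrite -[leLHS]expR0 ler_expR mulr_ge0// ?subr_ge0//.
    by rewrite !mulr_ge0// ltW.
  rewrite /C; lra.
have Fy : F y <= C * F y by rewrite ler_peMl// energy_ge0.
have [xt|xt] := leP x (t k); have [yt|yt] := leP y (t k).
- by apply: le_trans Fy; apply: (@energy_gap k); rewrite ?x1 ?y1.
- apply: (@le_trans _ _ (F (t k))); first by apply: (@energy_gap k); rewrite ?x1 ?stk'/=.
  by apply: energy_interval; rewrite ?lexx// ?y2 (ltW yt).
- apply: (@le_trans _ _ (C * F (t k))); first by apply: energy_interval; rewrite ?lexx// ?x2 (ltW xt).
  by rewrite ler_wpM2l; [|lra|apply: (@energy_gap k); rewrite ?y1 ?stk'/=].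
- by apply: energy_interval; rewrite ?x2 ?y2 ltW.
Qed.

(** [M] accumulates the factors of [energy_step]. The frequency [l] is arbitrary, and [x] and [y]
    can be exchanged, so this bounds the later energy both from above and from below. *)
Lemma energy_tail k x y : s k <= x <= 1 -> s k <= y <= 1 -> F x <= M k * F y.
Proof.
elim: k x y => [|k IH] x y.
  rewrite (sch_s0 sch) (sch_M0 sch) mul1r => hx hy.
  have -> : x = 1 by apply/eqP; rewrite eq_le andbC.
  have -> // : y = 1 by apply/eqP; rewrite eq_le andbC.
move=> /andP[x1 x2] /andP[y1 y2]; rewrite (sch_M sch).
have Mk := sch_M_ge1 k; have M0 : 0 <= M k by lra.
have sk1 := sch_s_le1 sch k.
have sks : s k.+1 <= s k := le_trans (sch_st sch k) (st k).
set C := 3 * _.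
have C1 : 1 <= C.
  have : 1 <= expR (2 * (8 * eps k * L k) * (s k - t k)).
    rewrite -[leLHS]expR0 ler_expR mulr_ge0// ?subr_ge0//.
    by rewrite !mulr_ge0// ltW.
  rewrite /C; lra.
have C0 : 0 <= C by lra.
have step z w : s k.+1 <= z <= s k -> s k.+1 <= w <= s k -> F z <= C * F w.
  exact: energy_step.
clearbody C.
have [xs|xs] := leP x (s k); have [ys|ys] := leP y (s k).
- apply: (@le_trans _ _ (C * F y)); first by apply: step; rewrite ?x1 ?y1.
  by rewrite -mulrA ler_peMl// mulr_ge0// energy_ge0.
- apply: (@le_trans _ _ (C * F (s k))); first by apply: step; rewrite ?x1 ?sks/=.
  rewrite (mulrC (M k)) -mulrA ler_wpM2l//; apply: IH; first by rewrite lexx.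
  by rewrite ltW.
- apply: (@le_trans _ _ (M k * F (s k))); first by apply: IH; rewrite ?lexx// ltW.
  rewrite -mulrA; apply: ler_wpM2l => //; apply: step; rewrite ?y1 ?sks/= //.
- apply: (@le_trans _ _ (M k * F y)); first by apply: IH; rewrite ltW.
  by rewrite -mulrA ler_wpM2l// ler_peMl// energy_ge0.
Qed.

(** Before s_(k+1) the coefficient is only known to be within 1/2 of 1, but this time is at most 1 /
    L_k, so [energy_flat] loses at most a factor exp(1/2) <= 2. From s_(k+1) to t_k the energy is
    constant. *)
Lemma energy_head k x : l = L k -> 0 <= x <= t k -> F x <= 2 * F (t k).
Proof.
move=> lE /andP[x0 xt]; have st' := sch_st sch k.
have Ft : 0 <= F (t k) by exact: energy_ge0.
have [xs|xs] := leP (s k.+1) x.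
  apply: (@le_trans _ _ (F (t k))); last by lra.
  by apply: (@energy_gap k); rewrite ?xs ?st'/=.
have [sp _] := sch_pos sch k.+1.
have o : oscillator c l 0 (s k.+1) u u'.
  by apply: oscillatorW osc => //; exact: sch_s_le1 sch k.+1.
have half : 0 <= 1 / 2 :> R by lra.
have hx : 0 <= x <= s k.+1 by rewrite x0 ltW.
have hs : 0 <= s k.+1 <= s k.+1 by rewrite lexx ltW.
have := energy_flat l0 half o _ hs hx.
move=> h; have {h} h := h _; apply: le_trans (h _) _.
  by move=> z _; have /andP[? ?] := crange z; rewrite ler_norml; apply/andP; split; lra.
have Fs : F (s k.+1) <= F (t k) by apply: (@energy_gap k); rewrite ?lexx ?st'.
rewrite mulrC; apply: ler_pM => //; rewrite ?expR_ge0 ?energy_ge0//.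
have : l * (1 / 2) * (s k.+1 - 0) <= 1 / 2.
  rewrite subr0 mulrAC -[leRHS]mul1r ler_wpM2r// lE.
  have := sch_slam sch k; rewrite ler_pdivlMr// mulrC//.
move=> h1; apply: (@le_trans _ _ (expR (1 / 2))); first by rewrite ler_expR.
(* From exp(-1/2) >= 1 - 1/2 one gets exp(1/2) <= 2. *)
have := expR_ge1Dx (- (1 / 2) : R); rewrite expRN => h2.
have E0 : 0 < expR (1 / 2) :> R := expR_gt0 _.
have : expR (1 / 2) * (1 - 1 / 2) <= 1 :> R.
  by rewrite -[leRHS](@mulfV _ (expR (1 / 2) : R)) ?gt_eqF// ler_pM2l.
lra.
Qed.

(** By uniqueness the mode coincides on the interval with the explicit [rsol]. Its exponent is
    nondecreasing, so no time of the interval has a larger exponential factor than [s k]. *)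
Lemma energy_resonance k x al : l = L k -> u (t k) = 0 -> u' (t k) = al ->
  t k <= x <= s k ->
  F x <= 5 * (al ^+ 2 * expR (eps k * (L k * (s k - t k)))) /\
  F (s k) = al ^+ 2 * expR (eps k * (L k * (s k - t k))).
Proof.
move=> lE u0 u1 hx; have [_ tp] := sch_pos sch k; have stk := st k.
have o : oscillator c l (t k) (s k) u u'.
  by apply: oscillatorW osc; [exact: ltW|exact: sch_s_le1 sch k].
pose w := rsol (eps k) (L k) (t k) al; pose w' := rsol' (eps k) (L k) (t k) al.
have ow : oscillator c l (t k) (s k) w w'.
  move=> z hz; have [] := @rsol_oscillator _ (eps k) (L k) (t k) (L0 k) al (t k) (s k) z hz.
  by rewrite lE (wcoef_in sch hz).
have [w0 w1] := rsol_start (eps k) (L k) (t k) al.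
have lp : 0 < l by rewrite lE.
have c1 z : t k <= z <= s k -> `|c z - 1| <= 1.
  by move=> _; have /andP[? ?] := crange z; rewrite ler_norml; apply/andP; split; lra.
have eq z : t k <= z <= s k -> F z = energy (L k) w w' z.
  move=> hz; have [e1 e2] := oscillator_unique lp c1 o ow (etrans u0 (esym w0))
    (etrans u1 (esym w1)) hz.
  by rewrite /energy e1 e2 lE.
have sE := rsol_end (eps k) (sin_ph_end sch k : sin (L k * (s k - t k)) = 0) al.
split; last by rewrite eq ?sE// lexx stk.
rewrite eq//; have h := rsol_energy (t k) (eps_ge0 k) (eps_le k) (L0 k) al x; apply: (le_trans h).
rewrite ler_wpM2l// ler_wpM2l ?sqr_ge0// -expRM_natl ler_expR.
have -> : eps k * (L k * (s k - t k)) = 2%:R * rexpo (eps k) (L k * (s k - t k)).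
  by rewrite /rexpo [sin _](sin_ph_end sch k) mul0r subr0; field.
rewrite ler_wpM2l//; apply: rexpo_le; first exact: eps_ge0.
by case/andP: hx => h1 h2; rewrite ler_wpM2l ?lerB// ltW.
Qed.

End Solution.
End Energies.

Lemma series_eventually_geometric {R : realType} (a : nat -> R) (C : R) (K : nat) :
  (forall k, 0 <= a k) -> 0 <= C ->
  (forall k, (K <= k)%N -> a k <= C * (1 / 2) ^+ k) -> cvgn (series a).
Proof.
(* The terms before K are absorbed into the constant [B]. *)
move=> a0 C0 aC; pose B := C + \sum_(j < K) a j * 2 ^+ j.
have S0 : 0 <= \sum_(j < K) a j * 2 ^+ j by apply: sumr_ge0 => j _; rewrite mulr_ge0// exprn_ge0.
have B0 : 0 <= B by rewrite addr_ge0.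
have h0 (k : nat) : 0 <= (1 / 2) ^+ k :> R by rewrite exprn_ge0.
apply: (@series_le_cvg _ _ (geometric B (1 / 2))) => [k//|k|k|].
- by rewrite /geometric/= mulr_ge0.
- rewrite /geometric/=; have [kK|kK] := ltnP k K; last first.
    by apply: le_trans (aC _ kK) _; rewrite ler_wpM2r// lerDl.
  have e : a k = a k * 2 ^+ k * (1 / 2) ^+ k.
    by rewrite -mulrA -exprMn (_ : 2 * (1 / 2) = 1) ?expr1n ?mulr1//; field.
  rewrite {1}e ler_wpM2r// /B (bigD1 (Ordinal kK))//= addrCA lerDl addr_ge0//.
  by apply: sumr_ge0 => j _; rewrite mulr_ge0// exprn_ge0.
- by apply: is_cvg_geometric_series; rewrite ger0_norm//; lra.
Qed.

(** * The family of scalar modes *)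

Section ScalarFamily.
Context {R : realType}.
Variables (lam : nat -> R) (omega phi : R -> R).

(** The product of L and the energy is L^3 u^2 + L u'^2, the square of the V_(1/2) seminorm of the
    mode and also its Gevrey weight without the exponential. In these terms the operator side needs
    nothing else about the modes. *)
Lemma scalar_family :
  (forall k, 0 < lam k) -> (forall i j, (i < j)%N -> lam i < lam j) ->
  (forall M : R, exists k, M < lam k) ->
  (forall a, 0 <= a -> 0 <= omega a) -> {within `[0, +oo[, continuous omega} ->
  (forall a b, 0 <= a -> a < b -> omega a < omega b) -> omega 0 = 0 ->
  (forall a b, 0 < a -> a <= b -> a / omega a <= b / omega b) ->
  (forall s, 0 <= s -> 1 <= phi s) ->
  (s / phi s * omega (1 / s)) @[s --> +oo] --> +oo ->
  exists (n : nat -> nat) (c : R -> R) (u u' : nat -> R -> R),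
  [/\ (forall k, n k < n k.+1)%N /\ (forall k, 1 <= lam (n k)),
    (forall x, 1 / 2 <= c x <= 3 / 2) /\
      (forall a b, `|c a - c b| <= 20 * omega `|a - b|),
    forall k, oscillator c (lam (n k)) 0 1 (u k) (u' k),
    forall k x, 0 <= x <= 1 ->
      lam (n k) * energy (lam (n k)) (u k) (u' k) x <= 5 * (1 / 2) ^+ k &
    (forall r, 0 < r -> cvgn (series (fun k =>
      lam (n k) * energy (lam (n k)) (u k) (u' k) 0 * expR (r * phi (lam (n k)))))) /\
    (forall x eta, 0 < x <= 1 -> 0 < eta -> ~ cvgn (series (fun k =>
      lam (n k) * energy (lam (n k)) (u k) (u' k) x * lam (n k) `^ eta)))].
Proof.
move=> l0 li lu o0 oc oi oz oq p1 po.
have [n [N [s [t [M sch]]]]] := schedule_exists l0 li lu o0 oc oz p1 po.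
pose c := wcoef lam omega n s t; pose L k := lam (n k).
have L1 k : 1 <= L k := sch_lam sch k.
have L0 k : 0 < L k := lt_le_trans ltr01 (L1 k).
have M1 k : 1 <= M k := sch_M_ge1 sch o0 k.
have M0 k : 0 < M k := lt_le_trans ltr01 (M1 k).
pose g k := omega (1 / L k) * (L k * (s k - t k)).
have g0 k : 0 <= g k.
  by rewrite mulr_ge0 ?o0 ?divr_ge0 ?mulr_ge0 ?subr_ge0 ?(ltW (L0 k)) ?(ltW (sch_lt sch k)).
pose d k : R := (1 / 2) ^+ k / M k.
have h0 (k : nat) : 0 < (1 / 2) ^+ k :> R by rewrite exprn_gt0.
have d0 k : 0 < d k by rewrite divr_gt0.
have dh k : d k <= (1 / 2) ^+ k by rewrite ler_pdivrMr// ler_peMr// ltW.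
(* The slope at [t k] is tuned so that the gain [expR (g k)] brings L times the energy at [s k] to
   exactly [d k]. *)
pose al k : R := Num.sqrt (d k / L k * expR (- g k)).
have alE k : L k * al k ^+ 2 = d k * expR (- g k).
  have h : 0 <= d k / L k * expR (- g k).
    by rewrite mulr_ge0 ?expR_ge0// ltW// divr_gt0.
  by rewrite /al sqr_sqrtr//; field; rewrite !gt_eqF.
have cc : continuous c by exact: (wcoef_continuous sch).
have crange x : 1 / 2 <= c x <= 3 / 2 by exact: (wcoef_range sch).
have solE : forall k, exists uu : (R -> R) * (R -> R),
    [/\ uu.1 (t k) = 0, uu.2 (t k) = al k & oscillator c (L k) 0 1 uu.1 uu.2].
  move=> k; have [_ /ltW tp] := sch_pos sch k.
  have [u [u' [h1 h2 h3]]] := oscillator_exists (L k) (al k) cc crange tp.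
  by exists (u, u').
pose u k := (projT1 (cid (solE k))).1; pose u' k := (projT1 (cid (solE k))).2.
have uP k : [/\ u k (t k) = 0, u' k (t k) = al k & oscillator c (L k) 0 1 (u k) (u' k)].
  exact: (projT2 (cid (solE k))).
pose F k x := energy (L k) (u k) (u' k) x.
have F0 k x : 0 <= F k x by exact: energy_ge0.
have Lp k : 0 <= L k := ltW (L0 k).
have head k x : 0 <= x <= t k -> L k * F k x <= 2 * (d k * expR (- g k)).
  have [u0 u1 osc] := uP k; move=> hx.
  have := energy_head sch o0 (Lp k) osc erefl hx.
  have -> : energy (L k) (u k) (u' k) (t k) = al k ^+ 2.
    by rewrite /energy u0 u1 expr0n/= mulr0 addr0.
  move=> h.
  by rewrite -alE mulrCA ler_wpM2l.
have mid k x : t k <= x <= s k -> L k * F k x <= 5 * d k /\ L k * F k (s k) = d k.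
  have [u0 u1 osc] := uP k; move=> hx.
  have [h1 h2] := energy_resonance sch o0 osc erefl u0 u1 hx.
  have e : L k * (al k ^+ 2 * expR (g k)) = d k.
    by rewrite mulrA alE -mulrA -expRD addNr expR0 mulr1.
  split; last by rewrite /F h2.
  by rewrite -e mulrCA ler_wpM2l.
have tail k x : s k <= x <= 1 -> L k * F k x <= (1 / 2) ^+ k /\ d k <= M k * (L k * F k x).
  have [u0 u1 osc] := uP k; move=> hx; have sk1 := sch_s_le1 sch k.
  have hs : s k <= s k <= 1 by rewrite lexx.
  have st := sch_lt sch k.
  have [|_ e] := @mid k (s k); first by rewrite lexx ltW.
  have h1 := energy_tail sch o0 (Lp k) osc hx hs.
  have h2 := energy_tail sch o0 (Lp k) osc hs hx.
  split; last by rewrite -e mulrCA ler_wpM2l.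
  have -> : (1 / 2) ^+ k = M k * d k by rewrite /d (mulrC (M k)) divfK// gt_eqF.
  by rewrite -e mulrCA ler_wpM2l.
have eg k : expR (- g k) <= 1 by rewrite -[leRHS]expR0 ler_expR oppr_le0.
exists n, c, u, u'; split.
- by split => //; exact: sch_n sch.
- by split => // a b; exact: (wcoef_omega sch).
- by move=> k; have [] := uP k.
- move=> k x /andP[x0 x1]; rewrite -/(L k) -/(F k x).
  have dk := dh k; have hk := h0 k; have dk0 := d0 k.
  have [xt|xt] := leP x (t k).
    have h : L k * F k x <= 2 * (d k * expR (- g k)) by apply: head; rewrite x0.
    have : d k * expR (- g k) <= d k by rewrite ler_piMr// ltW.
    lra.
  have [xs|xs] := leP x (s k).
    by have [|h _] := @mid k x; [rewrite xs ltW|lra].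
  by have [|h _] := @tail k x; [rewrite x1 ltW|lra].
- split.
    (* From this index on r phi <= k phi <= g_k, so the factor [expR (- g k)] present at time 0
       absorbs the weight. *)
    move=> r r0; have [K rK] : exists K : nat, r <= K%:R.
      by exists (Num.bound r); apply/ltW/archi_boundP/ltW.
    apply: (@series_eventually_geometric _ _ 2 K) => // k.
      by rewrite !mulr_ge0 ?expR_ge0// ?(F0 k 0)//; exact: Lp.
    move=> kK; rewrite -/(L k) -/(F k 0).
    have [_ tp] := sch_pos sch k.
    have hx : 0 <= (0 : R) <= t k by rewrite lexx ltW.
    apply: le_trans (ler_wpM2r (expR_ge0 _) (head k 0 hx)) _.
    rewrite [leLHS](_ : _ = 2 * (d k * (expR (- g k) * expR (r * phi (L k))))); last by ring.
    rewrite -expRD; apply: ler_wpM2l => //.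
    rewrite -[leRHS]mulr1; apply: ler_pM => //; rewrite ?expR_ge0 ?(ltW (d0 k))//.
    rewrite -[leRHS]expR0 ler_expR.
    have := sch_phi sch k; rewrite -/(L k) -/(g k).
    have : r * phi (L k) <= k%:R * phi (L k).
      rewrite ler_wpM2r ?(le_trans _ (p1 _ (Lp k)))//.
      by apply: (le_trans rK); rewrite ler_nat.
    lra.
  (* The terms do not even tend to 0. Once s_k <= x, L times the energy is at least d_k / M_k = 1 /
     B with B = 2^k M_k^2; and B^k <= L_k gives B <= L_k^eta as soon as k >= 1 / eta. *)
  move=> x eta /andP[x0 x1] eta0 /cvg_series_cvg_0 h.
  have [K sK] := sch_s_small sch x0.
  have [K' etaK] : exists K' : nat, eta^-1 <= K'%:R.
    by exists (Num.bound eta^-1); apply/ltW/archi_boundP; rewrite invr_ge0 ltW.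
  have [K'' _ hK] := (cvgrPdist_lt _ _).1 h 1 ltr01.
  pose k := maxn (maxn K K') K''.
  have kK : (K <= k)%N by rewrite /k !leq_max leqnn.
  have kK' : (K' <= k)%N by rewrite /k !leq_max leqnn orbT.
  have kK'' : (K'' <= k)%N by rewrite /k !leq_max leqnn !orbT.
  have := hK k kK''; rewrite sub0r normrN -/(L k) -/(F k x).
  apply/negP; rewrite -leNgt; apply: le_trans (ler_norm _).
  have sx : s k <= x <= 1 by rewrite x1 (le_trans _ sK)// (sch_s_le sch).
  have [_ hd] := tail k x sx.
  pose B := 2 ^+ k * M k ^+ 2.
  have B1 : 1 <= B by rewrite /B -[leLHS]mulr1 ler_pM// exprn_ege1// ler1n.
  have B0 : 0 < B := lt_le_trans ltr01 B1.
  have LB : B <= L k `^ eta.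
    have e1 : B <= (B ^+ k) `^ eta.
      move: B B1 B0 => b b1 b0.
      have -> : (b ^+ k) `^ eta = b `^ (k%:R * eta) by rewrite powRrM powR_mulrn// ltW.
      apply: (@le_trans _ _ (b `^ 1)); first by rewrite powRr1// ltW.
      apply: ler_powR => //.
      rewrite -ler_pdivrMr// div1r; apply: (le_trans etaK); by rewrite ler_nat.
    apply: le_trans e1 _; apply: ge0_ler_powR.
    - exact: ltW.
    - by rewrite nnegrE exprn_ge0// ltW.
    - by rewrite nnegrE.
    - exact: sch_big sch k.
  have e2 : B^-1 <= L k * F k x.
    rewrite -(@ler_pM2l _ (M k))//; apply: le_trans hd.
    rewrite /d /B invfM mulrA (mulrC (M k)) -mulrA.
    rewrite (_ : (1 / 2) ^+ k = (2 ^+ k)^-1); last by rewrite mul1r exprVn.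
    by rewrite ler_wpM2l ?invr_ge0 ?exprn_ge0// expr2 invfM mulrA divff ?gt_eqF// mul1r.
  have e3 : B^-1 * B <= L k * F k x * L k `^ eta.
    by apply: ler_pM => //; rewrite ?invr_ge0 ltW.
  by rewrite mulVf ?gt_eqF// in e3.
Qed.

End ScalarFamily.

(** * The vector-valued solution *)

Lemma derive_quotient_cvg {R : realType} (f : R -> R) (x d : R) : is_derive x 1 f d ->
  (s - x)^-1 * (f s - f x) @[s --> x^'] --> d.
Proof.
move=> [df <-]; apply/cvgrPdist_lt => e e0.
have /cvgrPdist_lt/(_ e e0) := df.
rewrite /derive/= => -[r /= r0 hr]; exists r => //= s xs sx.
have := hr (s - x); rewrite /= sub0r normrN distrC => /(_ xs).
rewrite subr_eq0 => /(_ sx).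
by rewrite [_%:A]mulr1 subrK.
Qed.

(** It turns bounds on derivatives that are uniform in time into a domination of the difference
    quotients by the same series. *)
Lemma quotient_MVT {R : realType} (f df : R -> R) (a b x y : R) : y != x ->
  (forall z, a <= z <= b -> is_derive z 1 f (df z)) ->
  a <= x <= b -> a <= y <= b ->
  exists2 z, a <= z <= b & (y - x)^-1 * (f y - f x) = df z.
Proof.
move=> yx h /andP[ax xb] /andP[ay yb].
have [xy|xy] := leP x y.
  have [z /andP[xz zy]|z /andP[xz zy] e] := @MVT_is_derive _ f df _ _ xy.
    by apply: h; rewrite (le_trans ax)// (le_trans zy).
  exists z; first by rewrite (le_trans ax)// (le_trans zy).
  by rewrite e mulrCA mulVf ?mulr1// subr_eq0.
have [z /andP[xz zy]|z /andP[xz zy] e] := @MVT_is_derive _ f df _ _ (ltW xy).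
  by apply: h; rewrite (le_trans ay)// (le_trans zy).
exists z; first by rewrite (le_trans ay)// (le_trans zy).
have -> : f y - f x = df z * (y - x) by rewrite -opprB e; ring.
by rewrite mulrCA mulVf ?mulr1// subr_eq0.
Qed.

Section Dominated.
Context {R : realType} {H : completeNormedModType R} (ip : inner_product H).
Variable f : nat -> H.
Hypothesis f_orthonormal : forall i j, ip (f i) (f j) = (i == j)%:R.

Lemma half_series_cvg (C : R) : cvgn (series (fun k => C * (1 / 2) ^+ k)).
Proof. by apply: is_cvg_geometric_series; rewrite ger0_norm//; lra. Qed.

Lemma ell2_half (a : nat -> R) (C : R) : (forall k, a k ^+ 2 <= C * (1 / 2) ^+ k) -> ell2 a.
Proof.
move=> h; apply: (@series_le_cvg _ _ (fun k => C * (1 / 2) ^+ k)) => [k|k|//|].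
- exact: sqr_ge0.
- exact: le_trans (sqr_ge0 _) (h k).
- exact: half_series_cvg.
Qed.

Lemma norm_synth_dominated (a : nat -> R) (C : R) (K : nat) :
  (forall k, a k ^+ 2 <= C * (1 / 2) ^+ k) ->
  `|synth f a| ^+ 2 <= \sum_(k < K) a k ^+ 2 + 2 * C * (1 / 2) ^+ K.
Proof.
move=> h; have la := ell2_half h.
have C0 : 0 <= C by have := le_trans (sqr_ge0 _) (h 0%N); rewrite expr0 mulr1.
have na := norm_synth f_orthonormal la.
rewrite -(cvg_lim _ na)//; apply: limr_le; first by apply/cvg_ex; eexists; exact: na.
exists K => // m /= Km; rewrite /series/= -(subnKC Km).
elim: (m - K)%N => [|j IH].
  by rewrite addn0 big_mkord lerDl !mulr_ge0// exprn_ge0.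
(* Subtracting the geometric tail that remains makes the bound inductive. *)
suff : \sum_(0 <= k < K + j.+1) a k ^+ 2 <=
    \sum_(k < K) a k ^+ 2 + 2 * C * (1 / 2) ^+ K - 2 * C * (1 / 2) ^+ (K + j.+1).
  move/le_trans; apply; rewrite gerBl !mulr_ge0// exprn_ge0//.
elim: j.+1 => [|i IHi]; first by rewrite addn0 addrK big_mkord.
rewrite addnS big_nat_recr//=; apply: le_trans (lerD IHi (h _)) _.
rewrite exprS; set X := \sum_(_ < _) _; set Y := (1 / 2) ^+ K; set Z := (1 / 2) ^+ _; lra.
Qed.

(** Dominated convergence for orthonormal series: the tail is small uniformly along the filter, and
    the finite head vanishes term by term. *)
Lemma synth_dominated_cvg (T : Type) (F : set_system T) {FF : Filter F}
    (a : T -> nat -> R) (C : R) :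
  (\forall x \near F, forall k, a x k ^+ 2 <= C * (1 / 2) ^+ k) ->
  (forall k, a x k @[x --> F] --> (0 : R)) ->
  `|synth f (a x)| @[x --> F] --> (0 : R).
Proof.
move=> dom ak; apply/cvgrPdist_lt => e e0.
have e20 : 0 < e ^+ 2 / 2 by rewrite divr_gt0// exprn_gt0.
have hC : 2 * C * (1 / 2) ^+ K @[K --> \oo] --> 2 * C * 0.
  by apply: cvgMr; apply: cvg_expr; rewrite ger0_norm//; lra.
rewrite mulr0 in hC; have [K _ hK] := (cvgrPdist_lt _ _).1 hC _ e20.
have {hK} := hK K (leqnn K); rewrite sub0r normrN => hK.
have sK : \sum_(k < K) a x k ^+ 2 @[x --> F] --> (0 : R).
  elim: (K) => [|j IH].
    rewrite (_ : (fun x => _) = cst 0); first exact: cvg_cst.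
    by apply/funext => x; rewrite big_ord0.
  rewrite (_ : (fun x => _) = (fun x => \sum_(k < j) a x k ^+ 2 + a x j * a x j)); last first.
    by apply/funext => x; rewrite big_ord_recr/= expr2.
  have := cvgD IH (cvgM (ak j) (ak j)); rewrite mulr0 addr0.
  by move/(_ FF FF).
near=> x; rewrite sub0r normrN normr_id.
rewrite -(@ltr_pXn2r _ 2)// ?nnegrE// ?(ltW e0)//.
apply: le_lt_trans (@norm_synth_dominated (a x) C K _) _; first by near: x.
have h1 : \sum_(k < K) a x k ^+ 2 < e ^+ 2 / 2.
  apply: le_lt_trans (ler_norm _) _; rewrite -normrN -sub0r.
  by near: x; move/cvgrPdist_lt : sK; exact.
have := le_lt_trans (ler_norm _) hK; lra.
Unshelve. all: by end_near. Qed.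

End Dominated.

Section SynthLinear.
Context {R : realType} {H : completeNormedModType R} (ip : inner_product H).
Variable f : nat -> H.
Hypothesis f_orthonormal : forall i j, ip (f i) (f j) = (i == j)%:R.
Implicit Types a b : nat -> R.

Lemma synth0 : synth f (fun=> 0 : R) = 0.
Proof.
apply/cvg_lim => //; rewrite (_ : series _ = cst 0); first exact: cvg_cst.
by apply/funext => n; rewrite /series/= big1// => i _; rewrite scale0r.
Qed.

Lemma ell20 : ell2 (fun=> 0 : R).
Proof. by apply: (@ell2_half _ _ 0) => k; rewrite expr0n mul0r. Qed.

Lemma synthB a b : ell2 a -> ell2 b -> synth f a - synth f b = synth f (fun k => a k - b k).
Proof.
move=> la lb; rewrite addrC -scaleN1r -(synth_lin f_orthonormal)//.
by congr synth; apply/funext => k; ring.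
Qed.

Lemma synthZ x a : ell2 a -> x *: synth f a = synth f (fun k => x * a k).
Proof.
move=> la; rewrite -[LHS]addr0 -{1}synth0 -(synth_lin f_orthonormal)//; last exact: ell20.
by congr synth; apply/funext => k; ring.
Qed.

Lemma ell2B a b : ell2 a -> ell2 b -> ell2 (fun k => a k - b k).
Proof.
move=> la lb; apply: ell2D => //.
by apply: ell2_le lb => k; rewrite normrN.
Qed.

End SynthLinear.

(** * Regularity and equation of the assembled solution *)

Section Assembly.
Context {R : realType} {H : completeNormedModType R} (ip : inner_product H).
Variables (E : pvm ip) (f : nat -> H) (L : nat -> R).
Hypothesis f_orthonormal : forall i j, ip (f i) (f j) = (i == j)%:R.
Hypothesis L1 : forall k, 1 <= L k.
Hypothesis f_eigen : forall k, spectral_eigenvector E (f k) (L k ^+ 2).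

Local Notation m := (fun k => L k ^+ 2).

Let L0 k : 0 < L k. Proof. exact: lt_le_trans ltr01 (L1 k). Qed.

Lemma powR_sqr_sqr k b : ((L k ^+ 2) `^ b) ^+ 2 = L k `^ (4 * b).
Proof.
have Lk := ltW (L0 k).
rewrite -(powR_mulrn 2 Lk) -powRrM -(powR_mulrn 2 (powR_ge0 _ _)) -powRrM.
by congr (_ `^ _); ring.
Qed.

Lemma sqr_pow14 k : ((L k ^+ 2) `^ (1 / 4)) ^+ 2 = L k.
Proof. by rewrite powR_sqr_sqr (_ : 4 * (1 / 4) = 1) ?powRr1 ?ltW//; field. Qed.

Lemma sqr_pow34 k : ((L k ^+ 2) `^ (3 / 4)) ^+ 2 = L k ^+ 3.
Proof.
by rewrite powR_sqr_sqr (_ : 4 * (3 / 4) = 3%:R) ?powR_mulrn ?ltW//; field.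
Qed.

Lemma mul_pow34_14 k : (L k ^+ 2) `^ (3 / 4) * (L k ^+ 2) `^ (1 / 4) = L k ^+ 2.
Proof.
rewrite -powRD; last by rewrite (gt_eqF (exprn_gt0 2 (L0 k))) implybT.
by rewrite (_ : 3 / 4 + 1 / 4 = 1) ?powRr1 ?sqr_ge0//; field.
Qed.

Lemma graph_norm_dominated (b C : R) (F : set_system R) {FF : Filter F} (a : R -> nat -> R) :
  (\forall x \near F, forall k, a x k ^+ 2 <= C * (1 / 2) ^+ k /\
     (m k `^ b * a x k) ^+ 2 <= C * (1 / 2) ^+ k) ->
  (forall k, a x k @[x --> F] --> (0 : R)) ->
  graph_norm E b (synth f (a x)) @[x --> F] --> (0 : R).
Proof.
move=> dom ak.
have c1 : `|synth f (a x)| @[x --> F] --> (0 : R).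
  apply: (synth_dominated_cvg f_orthonormal (C := C)) ak.
  by apply: filterS dom => x h k; have [] := h k.
have c2 : `|synth f (fun k => m k `^ b * a x k)| @[x --> F] --> (0 : R).
  apply: (synth_dominated_cvg f_orthonormal (C := C)).
    by apply: filterS dom => x h k; have [] := h k.
  by move=> k; rewrite -(mulr0 (m k `^ b)); apply: cvgMr.
have c3 : `|synth f (a x)| + `|synth f (fun k => m k `^ b * a x k)| @[x --> F] --> (0 : R).
  by have := cvgD c1 c2; rewrite addr0; apply.
apply: (@squeeze_cvgr _ _ _ _ (cst 0) _ _ _ 0 (cvg_cst _) c3).
apply: filterS dom => x h.
have la : ell2 (a x) by apply: ell2_half => k; have [h1 _] := h k; exact: h1.
have lb : ell2 (fun k => m k `^ b * a x k).
  by apply: ell2_half => k; have [_ h1] := h k; exact: h1.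
rewrite (graph_norm_synth f_orthonormal f_eigen)// sqrtr_ge0/=.
set X := synth f (a x); set Y := synth f _.
rewrite -[leRHS]ger0_norm ?addr_ge0// -sqrtr_sqr ler_wsqrtr//.
have := mulr_ge0 (normr_ge0 X) (normr_ge0 Y); rewrite /= sqrrD mulr2n; lra.
Qed.

Variables (c : R -> R) (u u' : nat -> R -> R).
Hypothesis osc : forall k, oscillator c (L k) 0 1 (u k) (u' k).
Hypothesis bound : forall k x, 0 <= x <= 1 ->
  L k * energy (L k) (u k) (u' k) x <= 5 * (1 / 2) ^+ k.
Hypothesis crange : forall x, 1 / 2 <= c x <= 3 / 2.

Local Notation B k := (5 * (1 / 2) ^+ k).
Definition vsol (t : R) : H := synth f (fun k => u k t).
Definition vsol' (t : R) : H := synth f (fun k => u' k t).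

Lemma mode_bounds k x : 0 <= x <= 1 ->
  [/\ L k ^+ 3 * u k x ^+ 2 <= B k, L k * u' k x ^+ 2 <= B k, L k * u k x ^+ 2 <= B k,
      u k x ^+ 2 <= B k & u' k x ^+ 2 <= B k].
Proof.
move=> hx; have Lk := L1 k; have Lk0 := ltW (L0 k).
have := bound k hx; rewrite /energy mulrDr.
have -> : L k * (L k ^+ 2 * u k x ^+ 2) = L k ^+ 3 * u k x ^+ 2 by ring.
have p0 : 0 <= u k x ^+ 2 by exact: sqr_ge0.
have p1 : 0 <= u' k x ^+ 2 by exact: sqr_ge0.
have h1 : 0 <= L k * u' k x ^+ 2 by rewrite mulr_ge0.
have h2 : u k x ^+ 2 <= L k * u k x ^+ 2 by rewrite ler_peMl.
have h3 : u' k x ^+ 2 <= L k * u' k x ^+ 2 by rewrite ler_peMl.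
have h4 : L k * u k x ^+ 2 <= L k ^+ 3 * u k x ^+ 2.
  by rewrite ler_wpM2r// ler_eXnr.
by move=> h; split; lra.
Qed.

Let ell2_u x : 0 <= x <= 1 -> ell2 (fun k => u k x).
Proof. by move=> hx; apply: (@ell2_half _ _ 5) => k; have [] := mode_bounds k hx. Qed.

Let ell2_u' x : 0 <= x <= 1 -> ell2 (fun k => u' k x).
Proof. by move=> hx; apply: (@ell2_half _ _ 5) => k; have [] := mode_bounds k hx. Qed.

Let ell2_u14 x : 0 <= x <= 1 -> ell2 (fun k => m k `^ (1 / 4) * u k x).
Proof.
move=> hx; apply: (@ell2_half _ _ 5) => k; rewrite exprMn sqr_pow14.
by have [] := mode_bounds k hx.
Qed.

Let ell2_u'14 x : 0 <= x <= 1 -> ell2 (fun k => m k `^ (1 / 4) * u' k x).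
Proof.
move=> hx; apply: (@ell2_half _ _ 5) => k; rewrite exprMn sqr_pow14.
by have [] := mode_bounds k hx.
Qed.

Let ell2_u34 x : 0 <= x <= 1 -> ell2 (fun k => m k `^ (3 / 4) * u k x).
Proof.
move=> hx; apply: (@ell2_half _ _ 5) => k; rewrite exprMn sqr_pow34.
by have [] := mode_bounds k hx.
Qed.

Let sqrB_le (p q w b : R) : 0 <= w -> w * p ^+ 2 <= b -> w * q ^+ 2 <= b ->
  w * (p - q) ^+ 2 <= 4 * b.
Proof.
move=> w0 hp hq; have := mulr_ge0 w0 (sqr_ge0 (p + q)).
have -> : w * (p - q) ^+ 2 = 2 * (w * p ^+ 2) + 2 * (w * q ^+ 2) - w * (p + q) ^+ 2 by ring.
lra.
Qed.

Let sqrB_le1 (p q b : R) : p ^+ 2 <= b -> q ^+ 2 <= b -> (p - q) ^+ 2 <= 4 * b.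
Proof. by move=> hp hq; rewrite -[leLHS]mul1r; apply: sqrB_le; rewrite ?mul1r. Qed.

Let within_cvg (g : R -> R) (t dg : R) : is_derive t 1 g dg ->
  g s - g t @[s --> within `[0, 1] (nbhs t)] --> (0 : R).
Proof.
move=> /is_derive_continuous cg; rewrite -(subrr (g t)).
by apply: cvg_within_filter; apply: cvgB; [exact: cg|exact: cvg_cst].
Qed.

Lemma vsol'_cont : cont01 E (1 / 4) vsol'.
Proof.
move=> t; rewrite in_itv/= => ht; split.
  by apply/(pow_dom_synth f_orthonormal f_eigen); [exact: ell2_u'|exact: ell2_u'14].
apply: (@cvg_trans _ (graph_norm E (1 / 4) (synth f (fun k => u' k s - u' k t))
   @[s --> within `[0, 1] (nbhs t)])).
  apply: near_eq_cvg; near=> s.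
  have hs : 0 <= s <= 1.
    have : `[0, 1]%classic s by near: s; exact: withinT.
    by rewrite /= in_itv.
  by rewrite /vsol' (synthB f_orthonormal)//; exact: ell2_u'.
apply: (@graph_norm_dominated _ 20).
  near=> s => k.
  have hs : 0 <= s <= 1.
    have : `[0, 1]%classic s by near: s; exact: withinT.
    by rewrite /= in_itv.
  have [_ h1 _ _ h2] := mode_bounds k hs; have [_ h3 _ _ h4] := mode_bounds k ht.
  rewrite (_ : 20 * (1 / 2) ^+ k = 4 * B k); last by ring.
  split; first exact: sqrB_le1.
  by rewrite exprMn sqr_pow14; apply: sqrB_le => //; exact: ltW.
by move=> k; apply: within_cvg; exact: (osc k ht).2.
Unshelve. all: by end_near. Qed.

Lemma vsol_cont : cont01 E (3 / 4) vsol.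
Proof.
move=> t; rewrite in_itv/= => ht; split.
  by apply/(pow_dom_synth f_orthonormal f_eigen); [exact: ell2_u|exact: ell2_u34].
apply: (@cvg_trans _ (graph_norm E (3 / 4) (synth f (fun k => u k s - u k t))
   @[s --> within `[0, 1] (nbhs t)])).
  apply: near_eq_cvg; near=> s.
  have hs : 0 <= s <= 1.
    have : `[0, 1]%classic s by near: s; exact: withinT.
    by rewrite /= in_itv.
  by rewrite /vsol (synthB f_orthonormal)//; exact: ell2_u.
apply: (@graph_norm_dominated _ 20).
  near=> s => k.
  have hs : 0 <= s <= 1.
    have : `[0, 1]%classic s by near: s; exact: withinT.
    by rewrite /= in_itv.
  have [h1 _ _ h2 _] := mode_bounds k hs; have [h3 _ _ h4 _] := mode_bounds k ht.
  rewrite (_ : 20 * (1 / 2) ^+ k = 4 * B k); last by ring.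
  split; first exact: sqrB_le1.
  by rewrite exprMn sqr_pow34; apply: sqrB_le => //; rewrite exprn_ge0// ltW.
by move=> k; apply: within_cvg; exact: (osc k ht).1.
Unshelve. all: by end_near. Qed.

Let punctured (t : R) : \forall s \near within `[0, 1] t^', 0 <= s <= 1 /\ s != t.
Proof.
rewrite /within/=; apply: filterS (nbhs_dnbhs_neq t) => s st.
by rewrite in_itv.
Qed.

Lemma vsol_deriv : deriv01 E (1 / 4) vsol vsol'.
Proof.
move=> t; rewrite in_itv/= => ht; split.
- by apply/(pow_dom_synth f_orthonormal f_eigen); [exact: ell2_u|exact: ell2_u14].
- by apply/(pow_dom_synth f_orthonormal f_eigen); [exact: ell2_u'|exact: ell2_u'14].
apply: (@cvg_trans _ (graph_norm E (1 / 4)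
   (synth f (fun k => (s - t)^-1 * (u k s - u k t) - u' k t))
   @[s --> within `[0, 1] t^'])).
  apply: near_eq_cvg; near=> s.
  have [hs _] : 0 <= s <= 1 /\ s != t by near: s; exact: punctured.
  have lus := ell2_u hs; have lut := ell2_u ht; have lu't := ell2_u' ht.
  have lB := ell2B lus lut.
  rewrite /vsol /vsol' (synthB f_orthonormal)// (synthZ f_orthonormal)//.
  by rewrite (synthB f_orthonormal)//; exact: ell2Z.
apply: (@graph_norm_dominated _ 20).
  near=> s => k.
  have [hs st] : 0 <= s <= 1 /\ s != t by near: s; exact: punctured.
  have [z hz ->] := quotient_MVT st (fun x hx => (osc k hx).1) ht hs.
  have [_ h1 _ _ h2] := mode_bounds k hz; have [_ h3 _ _ h4] := mode_bounds k ht.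
  rewrite (_ : 20 * (1 / 2) ^+ k = 4 * B k); last by ring.
  split; first exact: sqrB_le1.
  by rewrite exprMn sqr_pow14; apply: sqrB_le => //; exact: ltW.
move=> k; rewrite -(subrr (u' k t)); apply: cvgB; last exact: cvg_cst.
by apply: cvg_within_filter; apply: derive_quotient_cvg; exact: (osc k ht).1.
Unshelve. all: by end_near. Qed.

(** A supremum over the empty set would be -oo, so the zero vector is exhibited as an admissible
    test vector. *)
Lemma dual_norm_ge0 b (l : H -> R) : (0 <= dual_norm E b l)%E.
Proof.
have z0 : ell2 (fun=> 0 : R) := ell20.
have zb : ell2 (fun k => m k `^ b * 0).
  by rewrite (_ : (fun k => _) = fun=> 0)//; apply/funext => k; rewrite mulr0.
apply: (@le_trans _ _ (`|l 0|%:E)); first by rewrite lee_fin.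
apply: ereal_sup_ubound; exists 0 => //=; rewrite -(synth0 f); split.
  exact/(pow_dom_synth f_orthonormal f_eigen).
rewrite (graph_norm_synth f_orthonormal f_eigen)// synth0.
rewrite (_ : (fun k => _) = fun=> 0); last by apply/funext => k; rewrite mulr0.
by rewrite synth0 normr0 expr0n addr0 sqrtr0.
Qed.

Lemma vsol_wave : wave_solution E c vsol vsol'.
Proof.
exists (fun t w => - (c t * op_dual E (vsol t) w)); split; last first.
  by move=> t _ w _; rewrite addNr.
move=> t; rewrite in_itv/= => ht.
pose q s k := (s - t)^-1 * (u' k s - u' k t).
(* The error of the difference quotient in the dual space is A^(1/4) applied, in the weak sense, to
   [synth f (z s)]. Its dual norm is then at most the norm of that vector in H. *)
pose z s k := m k `^ (- (1 / 4)) * (q s k + c t * (L k ^+ 2 * u k t)).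
(* By the mean value theorem the quotient is -L^2 c u at an intermediate time, leaving L^3 times the
   square of a difference of two values of c u. The constant is 45 = 4 * (9/4) * 5, with c^2 <=
   9/4. *)
have zb : \forall s \near within `[0, 1] t^', forall k, z s k ^+ 2 <= 45 * (1 / 2) ^+ k.
  near=> s => k.
  have [hs st] : 0 <= s <= 1 /\ s != t by near: s; exact: punctured.
  have [x hx e] := quotient_MVT st (fun x hx => (osc k hx).2) ht hs.
  have [h1 _ _ _ _] := mode_bounds k hx; have [h2 _ _ _ _] := mode_bounds k ht.
  rewrite /z /q e exprMn powRN exprVn sqr_pow14.
  have -> : (L k)^-1 * (- (L k ^+ 2 * c x * u k x) + c t * (L k ^+ 2 * u k t)) ^+ 2 =
    L k ^+ 3 * (c t * u k t - c x * u k x) ^+ 2 by field; rewrite gt_eqF.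
  have cB y v : L k ^+ 3 * v ^+ 2 <= B k -> L k ^+ 3 * (c y * v) ^+ 2 <= 9 / 4 * B k.
    move=> hv; have /andP[c1 c2] := crange y.
    rewrite exprMn mulrCA; apply: ler_pM => //; rewrite ?sqr_ge0//.
      by rewrite mulr_ge0 ?sqr_ge0// exprn_ge0// ltW.
    nra.
  have -> : 45 * (1 / 2) ^+ k = 4 * (9 / 4 * B k) :> R by lra.
  by apply: sqrB_le; [rewrite exprn_ge0// ltW|exact: cB|exact: cB].
have z0 k : z s k @[s --> within `[0, 1] t^'] --> (0 : R).
  rewrite -(mulr0 (m k `^ (- (1 / 4)))); apply: cvgMr.
  rewrite -(addNr (c t * (L k ^+ 2 * u k t))); apply: cvgD; last exact: cvg_cst.
  apply: cvg_within_filter.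
  have -> : - (c t * (L k ^+ 2 * u k t)) = - (L k ^+ 2 * c t * u k t) by ring.
  by apply: derive_quotient_cvg; exact: (osc k ht).2.
have cz := synth_dominated_cvg f_orthonormal zb z0.
have cz' : `|synth f (z s)|%:E @[s --> within `[0, 1] t^'] --> (0%E : \bar R).
  by apply: cvg_EFin; [near=> s|exact: cz].
apply: (@squeeze_cvge _ _ _ _ (cst 0%E) _ _ _ 0%E (cvg_cst _) cz').
near=> s; rewrite dual_norm_ge0/=.
have [hs st] : 0 <= s <= 1 /\ s != t by near: s; exact: punctured.
have lz : ell2 (z s).
  apply: (@ell2_half _ _ 45); near: s; exact: zb.
have lu's := ell2_u' hs; have lu't := ell2_u' ht.
have lq : ell2 (q s) by apply: ell2Z; exact: ell2B.
apply: dual_norm_le => // w dw.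
rewrite /vsol' (synthB f_orthonormal)// (synthZ f_orthonormal); last exact: ell2B.
rewrite opprK /vsol.
rewrite (op_dual_synth f_orthonormal f_eigen (z := z s))//.
- exact: ip_le.
- exact: ell2_u.
- exact: ell2_u34.
- move=> k; rewrite mul_pow34_14 /z [RHS]mulrA powRN mulfV ?mul1r//.
  by rewrite gt_eqF// powR_gt0// exprn_gt0.
Unshelve. all: by end_near. Qed.

(** The squared V_b seminorm of a mode is L^(2b + 2) u^2 + L^(2b) u'^2, which is L times the energy
    times L^(2b - 1). The excess exponent is positive exactly when b > 1/2. *)
Lemma vsol_irregular b t : 0 <= t <= 1 ->
  ~ cvgn (series (fun k => L k * energy (L k) (u k) (u' k) t * L k `^ (2 * b - 1))) ->
  ~ phase_space E b (vsol t, vsol' t).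
Proof.
move=> ht nc [/= d1 d2]; apply: nc.
have l1 := (pow_dom_synth f_orthonormal f_eigen _ (ell2_u ht)).1 d1.
have l2 := (pow_dom_synth f_orthonormal f_eigen _ (ell2_u' ht)).1 d2.
rewrite (_ : series _ = (fun j => series (fun k => (m k `^ ((b + 1) / 2) * u k t) ^+ 2) j +
  series (fun k => (m k `^ (b / 2) * u' k t) ^+ 2) j)); first exact: is_cvgD.
apply/funext => j; rewrite /series/= -big_split/=; apply: eq_bigr => k _.
rewrite !exprMn !powR_sqr_sqr /energy.
have e1 : L k * L k `^ (2 * b - 1) = L k `^ (4 * (b / 2)).
  rewrite -{1}(powRr1 (ltW (L0 k))) -powRD; last by rewrite (gt_eqF (L0 k)) implybT.
  by congr (_ `^ _); field.
have e2 : L k ^+ 2 * L k `^ (4 * (b / 2)) = L k `^ (4 * ((b + 1) / 2)).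
  rewrite -(powR_mulrn 2 (ltW (L0 k))) -powRD; last by rewrite (gt_eqF (L0 k)) implybT.
  by congr (_ `^ _); field.
by rewrite -e2 -e1; ring.
Qed.

(** The indices 3/4 and 1/4 give the weights L^3 on u^2 and L on u'^2, so each of the two series is
    dominated by that of L times the energy. *)
Lemma vsol_gevrey phi r : injective L ->
  cvgn (series (fun k => L k * energy (L k) (u k) (u' k) 0 * expR (r * phi (L k)))) ->
  gevrey E phi r (3 / 4) (vsol 0) /\ gevrey E phi r (1 / 4) (vsol' 0).
Proof.
move=> Li cs; have h01 : 0 <= (0 : R) <= 1 by rewrite lexx ler01.
have mi : injective (fun k => L k ^+ 2).
  move=> i j /eqP; rewrite eqrXn2 ?ltW// => /eqP; exact: Li.
have sE k : Num.sqrt (L k ^+ 2) = L k by rewrite sqrtr_sqr ger0_norm// ltW.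
have Lk0 k := ltW (L0 k).
have e0 k := expR_ge0 (r * phi (L k)).
split; apply: (gevrey_synth f_orthonormal f_eigen mi); [exact: ell2_u| |exact: ell2_u'|].
- apply: series_le_cvg cs => k; rewrite ?sE.
  + by rewrite mulr_ge0 ?sqr_ge0// mulr_ge0 ?powR_ge0.
  + by rewrite mulr_ge0// mulr_ge0// energy_ge0.
  + rewrite (_ : 4 * (3 / 4) = 3%:R) ?powR_mulrn//; last by field.
    rewrite mulrA; apply: ler_wpM2r => //; rewrite /energy mulrDr.
    have := mulr_ge0 (Lk0 k) (sqr_ge0 (u' k 0)).
    have -> : L k * (L k ^+ 2 * u k 0 ^+ 2) = u k 0 ^+ 2 * L k ^+ 3 by ring.
    lra.
- apply: series_le_cvg cs => k; rewrite ?sE.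
  + by rewrite mulr_ge0 ?sqr_ge0// mulr_ge0 ?powR_ge0.
  + by rewrite mulr_ge0// mulr_ge0// energy_ge0.
  + rewrite (_ : 4 * (1 / 4) = 1) ?powRr1//; last by field.
    rewrite mulrA; apply: ler_wpM2r => //; rewrite /energy mulrDr (mulrC _ (L k)).
    have := mulr_ge0 (Lk0 k) (mulr_ge0 (sqr_ge0 (L k)) (sqr_ge0 (u k 0))).
    lra.
Qed.

End Assembly.

Theorem proposition3p6 (R : realType) (H : completeNormedModType R)
    (ip : inner_product H)
    (H_separable : exists S : set H, countable S /\ dense S)
    (D : set H) (A : H -> H)
    (A_sa : self_adjoint ip D A)
    (A_ge0 : forall u, D u -> 0 <= ip (A u) u)
    (E : pvm ip) (E_A : spectral_resolution E D A)
    (e : nat -> H) (lam : nat -> R)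
    (e_orthonormal : forall i j, ip (e i) (e j) = (i == j)%:R)
    (lam_gt0 : forall k, 0 < lam k)
    (lam_increasing : forall i j, (i < j)%N -> lam i < lam j)
    (lam_unbounded : forall M : R, exists k, M < lam k)
    (e_eigen : forall k, D (e k) /\ A (e k) = lam k ^+ 2 *: e k)
    (omega : R -> R)
    (omega_ge0 : forall a, 0 <= a -> 0 <= omega a)
    (omega_cont : {within `[0, +oo[, continuous omega})
    (omega_increasing : forall a b, 0 <= a -> a < b -> omega a < omega b)
    (omega0 : omega 0 = 0)
    (omega_subadditive : forall a b, 0 <= a -> 0 <= b ->
      omega (a + b) <= omega a + omega b)
    (omega_quotient : forall a b, 0 < a -> a <= b ->
      a / omega a <= b / omega b)
    (phi : R -> R)
    (phi_ge1 : forall s, 0 <= s -> 1 <= phi s)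
    (phi_omega : (s / phi s * omega (1 / s)) @[s --> +oo] --> +oo) :
  exists (c : R -> R) (v v' : R -> H),
    (forall t, t \in `[0, 1] -> 1 / 2 <= c t <= 3 / 2) /\
    omega_continuous omega `[0, 1] c /\
    (forall r, 0 < r ->
      (gevrey E phi r (3 / 4) `*` gevrey E phi r (1 / 4)) (v 0, v' 0)) /\
    [/\ deriv01 E (1 / 4) v v', cont01 E (1 / 4) v', cont01 E (3 / 4) v &
        wave_solution E c v v'] /\
    (forall t, t \in `]0, 1] -> forall b, 1 / 2 < b ->
      ~ phase_space E b (v t, v' t)).
Proof.
have [n [c [u [u' [[nS L1] [crange comega] osc bound [head0 irr]]]]]] :=
  scalar_family lam_gt0 lam_increasing lam_unbounded omega_ge0 omega_cont
    omega_increasing omega0 omega_quotient phi_ge1 phi_omega.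
have n_lt : {homo n : i j / (i < j)%N} := homo_ltn ltn_trans nS.
have n_inj i j : (n i == n j) = (i == j).
  by apply/eqP/eqP => [|->//]; case: (ltngtP i j) => // /n_lt h nij; rewrite nij ltnn in h.
pose f k := e (n k); pose L k := lam (n k).
have f_orth i j : ip (f i) (f j) = (i == j)%:R by rewrite e_orthonormal n_inj.
(* The hypothesis on E enters here only; it turns the eigenvector relation for A into one for the
   projections. *)
have f_eigen k : spectral_eigenvector E (f k) (L k ^+ 2).
  by apply: fcalc_eigenvector; apply/E_A; exact: e_eigen.
have L_inj : injective L.
  move=> i j Lij; apply/eqP; rewrite -n_inj; apply/eqP.
  by case: (ltngtP (n i) (n j)) => // /lam_increasing; rewrite -/(L i) -/(L j) Lij ltxx.
exists c, (vsol f u), (vsol' f u'); split; first by move=> t _; exact: crange.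
split; first by exists 20 => a b _ _; exact: comega.
split=> [r r0|].
  exact: (vsol_gevrey f_orth L1 f_eigen bound L_inj (head0 r r0)).
split.
  split.
  - exact: (vsol_deriv f_orth L1 f_eigen osc bound).
  - exact: (vsol'_cont f_orth L1 f_eigen osc bound).
  - exact: (vsol_cont f_orth L1 f_eigen osc bound).
  - exact: (vsol_wave f_orth L1 f_eigen osc bound crange).
move=> t; rewrite in_itv/= => /andP[t0 t1] b b12.
apply: (vsol_irregular f_orth L1 f_eigen bound); first by rewrite ltW.
by apply: irr; [rewrite t0|lra].
Qed.
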